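(* For $\sigma>0$ and $n\in\mathbb{N}$ let $$G_n(x;\sigma^2)=\sum_{k=0}^n(-1)^{n-k}\binom nk e^{\frac{\sigma^2k(n-k)}{2}}x^k.$$ For every $\sigma>0$ and $n\in\mathbb{N}$, all zeros of $G_n(x;\sigma^2)$ are real and positive. For every $\sigma>0$, the empirical distribution of zeros of $G_n(x;\sigma^2/n)$ converges weakly, as $n\to\infty$, to a probability measure $\nu_{\sigma^2}$ on $[0,\infty)$ with $$S_{\nu_{\sigma^2}}(t)=e^{-\sigma^2\left(t+\frac12\right)},\quad t\in(-1,0),\qquad\Sigma_{\nu_{\sigma^2}}(z)=e^{\frac{\sigma^2}{2}\frac{z+1}{z-1}},\quad z\in(-\infty,0).$$
   Context: The empirical distribution of zeros of a polynomial $P$ of degree $n$ is $\frac1n\sum_{z\in\mathbb{C}:P(z)=0}\delta_z$ (zeros counted with multiplicity). For a probability measure $\nu\neq\delta_0$ on $[0,\infty)$ put $\psi_\nu(z)=\int_{[0,\infty)}\frac{uz}{1-uz}\,\nu(\mathrm{d}u)$; on $z\in(-\infty,0)$ this is a strictly increasing bijection onto $(\nu(\{0\})-1,0)$, with inverse $\psi_\nu^{-1}$. The $S$- and $\Sigma$-transforms are $S_\nu(t)=\frac{1+t}{t}\psi_\nu^{-1}(t)$ and $\Sigma_\nu(z)=S_\nu\left(\frac{z}{1-z}\right)=\frac1z\psi_\nu^{-1}\left(\frac{z}{1-z}\right)$. *)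

(* Defs.v *)
From HB Require Import structures.
From mathcomp Require Import all_boot all_order all_algebra.
From mathcomp Require Import complex.
From mathcomp Require Import all_classical all_reals all_analysis.
From mathcomp Require Import measurable_realfun.

Set Implicit Arguments.
Unset Strict Implicit.
Unset Printing Implicit Defensive.

Import Order.TTheory GRing.Theory Num.Theory.
Import numFieldNormedType.Exports.

Local Open Scope classical_set_scope.
Local Open Scope ring_scope.
Local Open Scope complex_scope.

(* [Gpoly n s2] is G_n(x; s2): the second argument is the variance sigma^2. *)
Definition Gpoly (R : realType) (n : nat) (s2 : R) : {poly R} :=
  \sum_(k < n.+1)
    ((-1) ^+ (n - k) * 'C(n, k)%:R * expR (s2 * k%:R * (n - k)%:R / 2)) *: 'X^k.

Definition Cpoly (R : realType) (p : {poly R}) : {poly R[i]} :=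
  map_poly (real_complex R) p.

(* [closed_field_poly_normal p] is a sequence r with
   p = lead_coef p *: \prod_(z <- r) ('X - z%:P); hence a zero occurs in r as
   many times as its multiplicity. *)
Definition zeros (R : realType) (p : {poly R[i]}) : seq R[i] :=
  sval (closed_field_poly_normal p).

Notation borel T := (g_sigma_algebraType (@open T)).

(* [R[i]^o] is [R[i]] with the topology of the complex modulus. *)
Notation Cborel R := (borel (R[i]^o)).

(* The value at constant polynomials is the null measure. *)
Definition empirical_zeros (R : realType) (p : {poly R[i]}) :
    {measure set (Cborel R) -> \bar R} :=
  mscale ((size p).-1%:R^-1 : R)%:nng
    (msum (fun i => \d_((zeros p)`_i : Cborel R)) (size (zeros p))).

Definition weakly_cvg (R : realType) (T : ptopologicalType)
    (mu_ : nat -> {measure set (borel T) -> \bar R})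
    (mu : {measure set (borel T) -> \bar R}) : Prop :=
  forall f : T -> R, continuous f -> bounded_fun f ->
    (\int[mu_ n]_z f z)%R @[n --> \oo] --> (\int[mu]_z f z)%R.

Definition toC (R : realType) : measurableTypeR R -> Cborel R :=
  real_complex R.

Lemma continuous_real_complex (R : realType) :
  continuous (real_complex R : R -> R[i]^o).
Proof.
move=> x; apply/cvgrPdist_lt => e; rewrite ltcE /= => /andP[/eqP eim e0].
have hx : \forall t \near x, `|x - t| < complex.Re e.
  exact: (@cvgr_dist_lt _ _ _ (nbhs x) _ idfun x cvg_id).
near=> t.
have -> : `|(real_complex R x : R[i]^o) - (real_complex R t)| = `|x - t|%:C.
  by rewrite -rmorphB normc_def /= expr0n addr0 sqrtr_sqr.
rewrite ltcE /= eim eqxx /=; near: t; exact: hx.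
Unshelve. all: by end_near.
Qed.

Lemma measurable_toC (R : realType) : measurable_fun setT (@toC R).
Proof.
apply: (@measurability _ _ _ _ setT (@toC R) (@open R[i]^o)) => // _ [A oA <-].
rewrite setTI.
apply: open_measurable.
by apply: open_comp oA => x _; exact: continuous_real_complex.
Qed.

HB.instance Definition _ (R : realType) :=
  isMeasurableFun.Build _ _ _ _ (@toC R) (@measurable_toC R).

Definition psi (R : realType) (nu : probability (measurableTypeR R) R)
    (z : R) : R :=
  (\int[nu]_(u in `[0, +oo[) (u * z / (1 - u * z)))%R.

(* Inverse of [psi nu] restricted to the negative half-line. Off the range of
   that restriction it is 0, so a nonzero value of [Stransform nu t] at t in
   (-1, 0) forces t to be in the domain (nu {0} - 1, 0) of the inverse. *)
Definition psi_inv (R : realType) (nu : probability (measurableTypeR R) R) :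
    R -> R :=
  'pinv_(fun=> 0) `]-oo, 0[ (psi nu).

Definition Stransform (R : realType) (nu : probability (measurableTypeR R) R)
    (t : R) : R :=
  (1 + t) / t * psi_inv nu t.

Definition Sigmatransform (R : realType)
    (nu : probability (measurableTypeR R) R) (z : R) : R :=
  Stransform nu (z / (1 - z)).

(* Main.v *)
Require Import Defs.
From HB Require Import structures.
From mathcomp Require Import all_boot all_order all_algebra.
From mathcomp Require Import complex polyrcf.
From mathcomp Require Import all_classical all_reals all_analysis.
From mathcomp Require Import measurable_realfun.
From mathcomp Require Import ring lra zify.

(** Write q = exp(s/2). The coefficients of G_n are powers of q, up to sign and
    binomial factor, with exponents k (n - k), and this gives two q-difference
    equations which carry the whole proof.

    Zeros. Pascal's rule gives
      G_(n+1)(x) = x q^n G_n(x/q) - G_n(q x)         ([Gpoly_rec]).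
    If r_0 < r_1 < ... are the zeros of G_n then the first term vanishes at
    q r_(j-1) and the second one at r_j / q. As long as consecutive zeros differ
    by a factor larger than q^2, the sign of the remaining term is known at both
    points and it changes between them. So G_(n+1) has one zero in each of the
    n + 1 gaps (q r_(j-1), r_j / q), and these new zeros are again separated by a
    factor larger than q^2 ([mesh_zerosS]).

    Resolvent means. For y > 0 put m_n(y) = (1/n) sum_i y / (y + r_i), where the
    r_i are now the zeros of G_n(x; v/n). It is y/n times the logarithmic
    derivative of prod_i (y + r_i). The equation
      q^n (x G_n'(x) - n G_n(x)) = q G_n'(q^2 x)     ([Gpoly_deriv])
    becomes, with t = q^-2 = exp(-v/n),
      m_n(y) = y q^(n-1) (1 - m_n(t y)) prod_i (t y + r_i) / (y + r_i).
    Every factor of the product is close to exp(-(v/n) y / (y + r_i)), so that in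
    the limit m = y exp(v/2) (1 - m) exp(-v m). Hence m_n(y) tends to the unique
    s in (0, 1) with y = s / (1 - s) exp(v (s - 1/2)) ([cvg_resolvent_mean]).

    Weak limit. Convergence of all resolvent means, together with tightness, gives
    weak convergence ([exists_weak_limit]). By partial fractions the means of all
    polynomials in 1 / (1 + x) converge. Such polynomials approximate indicators
    of half-lines well enough to force the quantile functions of the rows to
    converge off a countable set of levels. The limit law is the law of the limit
    quantile under the uniform distribution on [0, 1], and dominated convergence
    gives the convergence of the integrals.

    Transforms. At z = -1/y one has psi(z) = s - 1, so the relation between y and
    s says that psi inverts at t = s - 1 to t / (1 + t) exp(-v (t + 1/2)). *)

Set Implicit Arguments.
Unset Strict Implicit.
Unset Printing Implicit Defensive.

Import Order.TTheory GRing.Theory Num.Theory.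
Import numFieldNormedType.Exports.

Local Open Scope classical_set_scope.
Local Open Scope ring_scope.
Local Open Scope complex_scope.

(** * Real zeros, and their spacing *)

Section Coefs.
Context {R : realType}.
Implicit Types (s x : R) (n k : nat).

Definition Gcoef n s k : R :=
  (-1) ^+ (n - k) * 'C(n, k)%:R * expR (s * k%:R * (n - k)%:R / 2).

Lemma Gpoly_poly n s : Gpoly n s = \poly_(k < n.+1) Gcoef n s k.
Proof. by rewrite poly_def. Qed.

Lemma horner_Gpoly n s x : (Gpoly n s).[x] = \sum_(k < n.+1) Gcoef n s k * x ^+ k.
Proof. by rewrite Gpoly_poly horner_poly. Qed.

Lemma Gcoef_last n s : Gcoef n s n = 1.
Proof. by rewrite /Gcoef subnn binn !mul1r mulr0 mul0r expR0. Qed.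

Lemma size_Gpoly n s : size (Gpoly n s) = n.+1.
Proof. by rewrite Gpoly_poly size_poly_eq// Gcoef_last oner_neq0. Qed.

Lemma lead_coef_Gpoly n s : lead_coef (Gpoly n s) = 1.
Proof. by rewrite lead_coefE size_Gpoly/= Gpoly_poly coef_poly ltnSn Gcoef_last. Qed.

Lemma Gcoef_out n s k : (n < k)%N -> Gcoef n s k = 0.
Proof. by move=> nk; rewrite /Gcoef bin_small// mulr0 mul0r. Qed.

(** The base q for which the weights of the coefficients are the integer powers
    q^(k (n - k)), so that rescaling x by powers of q relates them. *)
Definition Gq s : R := expR (s / 2).

Lemma Gq_gt0 s : 0 < Gq s. Proof. exact: expR_gt0. Qed.

Lemma expR_Gq s (k : nat) : expR (s * k%:R / 2) = Gq s ^+ k.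
Proof. by rewrite /Gq -expRM_natl; congr expR; rewrite -mulr_natl; ring. Qed.

Lemma GcoefE n s k : Gcoef n s k = (-1) ^+ (n - k) * 'C(n, k)%:R * Gq s ^+ (k * (n - k)).
Proof. by rewrite -expR_Gq natrM mulrA. Qed.

(** Pascal's rule; passing from n to n + 1 changes the exponent k (n - k) by k or
    by n - k, which a rescaling of the variable by q or by 1/q absorbs. *)
Lemma Gpoly_rec n s x : (Gpoly n.+1 s).[x] =
  x * Gq s ^+ n * (Gpoly n s).[x / Gq s] - (Gpoly n s).[Gq s * x].
Proof.
have q0 : Gq s != 0 by rewrite gt_eqF ?Gq_gt0.
rewrite !horner_Gpoly big_ord_recl/=.
rewrite [X in _ - X](_ : _ = \sum_(k < n.+2) Gcoef n s k * (Gq s * x) ^+ k); last first.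
  by rewrite [RHS]big_ord_recr/= Gcoef_out// mul0r addr0.
rewrite [X in _ - X]big_ord_recl/= opprD addrCA; congr (_ + _).
  rewrite !GcoefE !subn0 !bin0 exprS !expr0; ring.
rewrite mulr_sumr -sumrB; apply: eq_bigr => k _; rewrite /bump/= add1n.
have kn := ltn_ord k; rewrite ltnS in kn.
rewrite !GcoefE subSS binS natrD expr_div_n exprMn exprS.
have -> : Gq s ^+ (k.+1 * (n - k)) = Gq s ^+ (k * (n - k)) * Gq s ^+ (n - k).
  by rewrite -exprD mulSn addnC.
have -> : Gq s ^+ n = Gq s ^+ k * Gq s ^+ (n - k) by rewrite -exprD subnKC.
have [kn'|kn'] := ltnP k n.
  have -> : (n - k)%N = (n - k.+1).+1 by rewrite subnSK.
  have -> : Gq s ^+ (k.+1 * (n - k.+1)) = Gq s ^+ (k * (n - k.+1)) * Gq s ^+ (n - k.+1).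
    by rewrite -exprD mulSn addnC.
  rewrite !exprS mulnS exprD.
  by field; rewrite expf_neq0.
rewrite bin_small ?ltnS//.
by field; rewrite expf_neq0.
Qed.

Lemma prod_sub_sign n j (r : nat -> R) x : (j <= n)%N ->
  (forall i, (i < j)%N -> r i < x) -> (forall i, (j <= i < n)%N -> x < r i) ->
  0 < (-1) ^+ (n - j) * \prod_(i < n) (x - r i).
Proof.
elim: n j => [|n IH] j.
  by rewrite leqn0 => /eqP -> _ _; rewrite big_ord0 mulr1 expr0.
rewrite leq_eqVlt => /predU1P[-> rx _|].
  by rewrite subnn mul1r prodr_gt0// => i _; rewrite subr_gt0; exact: rx.
rewrite ltnS => jn rx xr; rewrite big_ord_recr/= subSn// exprS.
have IHj : 0 < (-1) ^+ (n - j) * \prod_(i < n) (x - r i).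
  by apply: IH => // i /andP[ji i_n]; apply: xr; rewrite ji ltnW.
have xn : 0 < r n - x by rewrite subr_gt0 xr// jn/=.
rewrite [X in 0 < X](_ : _ = ((-1) ^+ (n - j) * \prod_(i < n) (x - r i)) * (r n - x)); last by ring.
exact: mulr_gt0.
Qed.

(** The multiplicative gap q^2 between consecutive zeros is what carries the
    induction on n. *)
Definition mesh_zeros n s (r : nat -> R) :=
  [/\ forall i, (i < n)%N -> 0 < r i,
      forall i, (i.+1 < n)%N -> Gq s ^+ 2 * r i < r i.+1
    & Gpoly n s = \prod_(i < n) ('X - (r i)%:P)].

Lemma Gq_gt1 s : 0 < s -> 1 < Gq s.
Proof. by move=> s0; rewrite /Gq expR_gt1; lra. Qed.

Lemma mesh_lt n s r i j : 0 < s -> mesh_zeros n s r -> (i < j)%N -> (j < n)%N ->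
  Gq s ^+ 2 * r i < r j.
Proof.
move=> s0 [r0 rq _]; elim: j => // j IH; rewrite ltnS leq_eqVlt => /predU1P[<-|ij] jn.
  exact: rq.
have rj := r0 j (ltnW jn).
apply: lt_trans (IH ij (ltnW jn)) _; apply: lt_trans (rq _ jn).
by rewrite ltr_pMl// exprn_egt1// Gq_gt1.
Qed.

Lemma horner_mesh_zeros n s r x : mesh_zeros n s r ->
  (Gpoly n s).[x] = \prod_(i < n) (x - r i).
Proof.
by case=> _ _ ->; rewrite horner_prod; apply: eq_bigr => i _; rewrite hornerXsubC.
Qed.

Lemma Gpoly_prod_zeros n s (r : nat -> R) :
  (forall i, (i < n)%N -> root (Gpoly n s) (r i)) ->
  (forall i j, (i < j)%N -> (j < n)%N -> r i < r j) ->
  Gpoly n s = \prod_(i < n) ('X - (r i)%:P).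
Proof.
move=> rr rlt.
rewrite (@all_roots_prod_XsubC _ (Gpoly n s) (mkseq r n)).
- rewrite lead_coef_Gpoly scale1r big_map -(big_mkord xpredT (fun i => 'X - (r i)%:P)).
  by rewrite /index_iota subn0.
- by rewrite size_mkseq size_Gpoly.
- by apply/allP => y /mapP; case=> i; rewrite mem_iota/= add0n => i_n ->; exact: rr.
- rewrite uniq_rootsE; apply/mkseq_uniqP => i j; rewrite !inE => i_n jn rij.
  have [ij|ji|//] := ltngtP i j.
    by have := rlt _ _ ij jn; rewrite rij ltxx.
  by have := rlt _ _ ji i_n; rewrite rij ltxx.
Qed.

(** In the recurrence one term vanishes at q r_(j-1), the other one at r_j / q.
    The surviving term has its argument moved by q^2 away from a zero of G_n; by the
    mesh condition this does not reach the next zero, so its sign is known. The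
    signs at the two ends are opposite, and the zeros found in adjacent gaps
    (q r_(j-1), r_j / q) and (q r_j, r_(j+1) / q) differ by more than q^2. *)
Lemma mesh_zerosS n s r : 0 < s -> mesh_zeros n s r -> exists r', mesh_zeros n.+1 s r'.
Proof.
move=> s0 mr; have [r0 rq _] := mr; have Gr x := horner_mesh_zeros x mr.
set q := Gq s; have q1 : 1 < q by exact: Gq_gt1.
have q0 : 0 < q by lra.
have qne : q != 0 by rewrite gt_eqF.
have qq : 1 < q ^+ 2 by rewrite exprn_egt1.
have Groot i : (i < n)%N -> (Gpoly n s).[r i] = 0.
  by move=> i_n; rewrite Gr (bigD1 (Ordinal i_n))//= subrr mul0r.
(* left end of the j-th gap; below the smallest zero the gap starts at 0 *)
pose lo j := if j is i.+1 then q * r i else 0.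
have lo0 j : (j <= n)%N -> 0 <= lo j.
  by case: j => // j jn; rewrite /lo mulr_ge0 ?ltW// r0.
have lo_sign j : (j <= n)%N -> 0 < (-1) ^+ (n - j) * - (Gpoly n.+1 s).[lo j].
  move=> jn; rewrite Gpoly_rec -/q.
  have -> : lo j * q ^+ n * (Gpoly n s).[lo j / q] = 0.
    case: j jn => [|j] jn; rewrite /lo ?mul0r//.
    by rewrite [q * r j]mulrC mulfK// Groot// mulr0.
  rewrite sub0r opprK Gr; apply: prod_sub_sign => //.
    move=> i ij; case: j jn ij => // j jn; rewrite ltnS leq_eqVlt /lo mulrA -expr2.
    move=> /predU1P[->|ij]; first by rewrite ltr_pMl// r0.
    apply: (@lt_trans _ _ (r j)); last by rewrite ltr_pMl// r0.
    by apply: lt_trans (mesh_lt s0 mr ij jn); rewrite ltr_pMl// r0// (ltn_trans ij).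
  move=> i /andP[ji i_n]; case: j ji jn => [|j] ji jn; rewrite /lo.
    by rewrite mulr0 r0.
  by rewrite mulrA -expr2; exact: (mesh_lt s0 mr).
(* the last gap is unbounded: there a large point replaces r_j / q *)
have hi_ex j : (j <= n)%N -> exists hi, [/\ lo j <= hi,
    (-1) ^+ (n - j) * - (Gpoly n.+1 s).[hi] < 0 & (j < n)%N -> hi = r j / q].
  rewrite leq_eqVlt => /predU1P[->|jn].
    have [|M HM] := @poly_pinfty_gt_lc _ (Gpoly n.+1 s); first by rewrite lead_coef_Gpoly.
    exists (Num.max M (lo n)); split; first by rewrite le_max lexx orbT.
      rewrite subnn expr0 mul1r oppr_lt0.
      apply: lt_le_trans (HM _ _); first by rewrite lead_coef_Gpoly.
      by rewrite le_max lexx.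
    by rewrite ltnn.
  exists (r j / q); split => //.
    case: j jn => [|j] jn; rewrite /lo; first by rewrite divr_ge0 ?ltW// r0.
    by rewrite ler_pdivlMr// mulrC mulrA -expr2 ltW// rq.
  rewrite Gpoly_rec -/q [q * _]mulrC divfK// Groot// subr0.
  rewrite mulrN oppr_lt0 mulrCA pmulr_rgt0; last first.
    by rewrite mulr_gt0 ?exprn_gt0// divr_gt0// r0.
  have rq2 : r j / q / q < r j.
    have rj := r0 _ jn; rewrite ltr_pdivrMr// ltr_pdivrMr// -mulrA -expr2.
    by rewrite ltr_pMr.
  rewrite Gr; apply: prod_sub_sign; first exact: ltnW.
    move=> i ij; rewrite ltr_pdivlMr// ltr_pdivlMr// -mulrA -expr2 mulrC.
    exact: (mesh_lt s0 mr).
  move=> i /andP[]; rewrite leq_eqVlt => /predU1P[<- //|ji] i_n.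
  apply: lt_trans rq2 _; apply: lt_trans (mesh_lt s0 mr ji i_n).
  by rewrite ltr_pMl// r0.
have zero_ex j : exists y, (j <= n)%N ->
    [/\ root (Gpoly n.+1 s) y, lo j < y & (j < n)%N -> y < r j / q].
  have [jn|] := leqP j n; last by exists 0.
  have [hi [lohi hisign hiE]] := hi_ex j jn.
  have [|y] := @poly_ivtoo _ (Gpoly n.+1 s) (lo j) hi lohi.
    have := lo_sign j jn; rewrite -signr_odd in hisign *.
    by case: odd hisign; rewrite ?expr0 ?expr1; nra.
  rewrite in_itv/= => /andP[loy yhi] ry; exists y => _; split=> // jn'.
  by rewrite -hiE.
have [r' r'P] := choice zero_ex.
have r'0 i : (i < n.+1)%N -> 0 < r' i.
  by rewrite ltnS => i_n; have [_ + _] := r'P i i_n; apply: le_lt_trans; exact: lo0.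
have r'q i : (i.+1 < n.+1)%N -> q ^+ 2 * r' i < r' i.+1.
  rewrite ltnS => i_n; have [_ _ /(_ i_n) h1] := r'P i (ltnW i_n).
  have [_ + _] := r'P i.+1 i_n; rewrite /lo; apply: lt_trans.
  by rewrite expr2 -mulrA ltr_pM2l// mulrC -ltr_pdivlMr.
exists r'; split=> //; apply: Gpoly_prod_zeros.
  by move=> i; rewrite ltnS => i_n; have [] := r'P i i_n.
move=> i j; elim: j => // j IH; rewrite ltnS leq_eqVlt => /predU1P[->|ij] jn.
  by apply: lt_trans (r'q _ jn); rewrite ltr_pMl// r'0// ltnW.
apply: lt_trans (IH ij (ltnW jn)) _.
by apply: lt_trans (r'q _ jn); rewrite ltr_pMl// r'0// ltnW.
Qed.

Lemma mesh_zeros_exists n s : 0 < s -> exists r, mesh_zeros n s r.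
Proof.
move=> s0; elim: n => [|n [r mr]]; last exact: mesh_zerosS mr.
by exists (fun=> 0); split=> //; exact: (@Gpoly_prod_zeros 0 s (fun=> 0)).
Qed.

End Coefs.

(** * A continuity theorem for means of resolvents *)

(** Integral against the empirical measure of the first n entries of row n of a
    triangular array. *)
Definition row_mean (R : realType) (x : nat -> nat -> R) (f : R -> R) (n : nat) : R :=
  n%:R^-1 * \sum_(i < n) f (x n i).

Section RowMean.
Context {R : realType} (x : nat -> nat -> R).
Implicit Types f g : R -> R.

Lemma row_meanD f g : row_mean x (f \+ g) = row_mean x f \+ row_mean x g.
Proof. by apply/funext => n; rewrite /row_mean big_split/= mulrDr. Qed.

Lemma row_meanZ (a : R) f : row_mean x (fun u => a * f u) = (fun n => a * row_mean x f n).
Proof. by apply/funext => n; rewrite /row_mean -mulr_sumr mulrCA. Qed.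

Lemma row_mean_dist f g (e : R) (n : nat) : (0 < n)%N ->
  (forall i, (i < n)%N -> `|f (x n i) - g (x n i)| <= e) ->
  `|row_mean x f n - row_mean x g n| <= e.
Proof.
move=> n0 fg; rewrite /row_mean -mulrBr -sumrB normrM ger0_norm ?invr_ge0//.
rewrite mulrC ler_pdivrMr ?ltr0n//.
apply: le_trans (ler_norm_sum _ _ _) _.
apply: (@le_trans _ _ (\sum_(i < n) e)); first by apply: ler_sum => i _; exact: fg.
by rewrite sumr_const card_ord mulr_natr.
Qed.

(** The limit is not known in advance, so completeness of the reals is used: the
    means of f form a Cauchy sequence. *)
Lemma cvg_row_mean_closed f :
  (forall e, 0 < e -> exists2 g, cvgn (row_mean x g) &
     forall n i, (i < n)%N -> `|f (x n i) - g (x n i)| <= e) ->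
  cvgn (row_mean x f).
Proof.
move=> H; apply/cauchy_cvgP; apply: cauchy_exP => e e0.
have e2 : 0 < e / 2 by rewrite divr_gt0.
have [g cg fg] := H _ e2.
exists (limn (row_mean x g)).
move/cvgrPdist_lt : cg => /(_ _ e2) cg.
change (\forall n \near \oo, `|limn (row_mean x g) - row_mean x f n| < e).
near=> n.
have h1 : `|limn (row_mean x g) - row_mean x g n| < e / 2 by near: n.
have h2 : `|row_mean x g n - row_mean x f n| <= e / 2.
  apply: row_mean_dist; first by near: n; exists 1%N.
  by move=> i ni; rewrite distrC; exact: fg.
have -> : limn (row_mean x g) - row_mean x f n = (limn (row_mean x g) - row_mean x g n) +
   (row_mean x g n - row_mean x f n) by ring.
by apply: (le_lt_trans (ler_normD _ _)); lra.
Unshelve. all: by end_near.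
Qed.

Lemma is_cvg_row_mean_scale (a : R) f :
  cvgn (row_mean x f) -> cvgn (row_mean x (fun u => a * f u)).
Proof. by move=> cf; rewrite row_meanZ; apply: is_cvgM => //; exact: is_cvg_cst. Qed.

Lemma is_cvg_row_mean_add f g : cvgn (row_mean x f) -> cvgn (row_mean x g) ->
  cvgn (row_mean x (f \+ g)).
Proof. by move=> cf cg; rewrite row_meanD; exact: is_cvgD. Qed.

Hypothesis x_gt0 : forall n i, (i < n)%N -> 0 < x n i.

Lemma eq_row_mean f g : (forall u, 0 < u -> f u = g u) -> row_mean x f = row_mean x g.
Proof.
move=> fg; apply/funext => n; rewrite /row_mean; congr (_ * _).
by apply: eq_bigr => i _; rewrite fg// x_gt0.
Qed.

Hypothesis cvg_resolvent : forall y, 0 < y -> cvgn (row_mean x (fun u => (y + u)^-1)).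

(** Partial fractions reduce a product of two distinct resolvents to a difference,
    hence lower the number of factors. Equal poles are reached as uniform limits of
    distinct ones. *)
Lemma is_cvg_row_mean_prod_resolvent (y : R) (ys : seq R) : 0 < y -> all (> 0) ys ->
  cvgn (row_mean x (fun u => (y + u)^-1 * \prod_(z <- ys) (z + u)^-1)).
Proof.
elim: ys y => [y y0 _|z ys IH y y0 /= /andP[z0 ys0]].
  rewrite (_ : (fun u => _) = (fun u => (y + u)^-1)); first exact: cvg_resolvent.
  by apply/funext => u; rewrite big_nil mulr1.
have neq w : 0 < w -> w != z ->
    cvgn (row_mean x (fun u => (w + u)^-1 * \prod_(z <- z :: ys) (z + u)^-1)).
  move=> w0 wz.
  rewrite (@eq_row_mean _ (fun u => ((z - w)^-1 * ((w + u)^-1 * \prod_(z <- ys) (z + u)^-1)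
     + - (z - w)^-1 * ((z + u)^-1 * \prod_(z <- ys) (z + u)^-1)))).
    by apply: is_cvg_row_mean_add; apply: is_cvg_row_mean_scale; exact: IH.
  move=> u u0; rewrite big_cons; field.
  by rewrite subr_eq0 [z == w]eq_sym wz !gt_eqF ?addr_gt0.
have [yz|] := eqVneq y z; last exact: neq.
pose C := \prod_(z <- z :: ys) z^-1.
have prod_gt0 (r : seq R) u : all (> 0) r -> 0 <= u -> 0 < \prod_(z <- r) (z + u)^-1.
  move=> /allP r0 u0; rewrite big_seq prodr_gt0// => w wr.
  by rewrite invr_gt0 ltr_wpDr//; exact: r0.
have zys0 : all (> 0) (z :: ys) by rewrite /= z0.
have C0 : 0 < C.
  rewrite /C; under eq_bigr do rewrite -[X in X^-1]addr0.
  exact: prod_gt0.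
apply: cvg_row_mean_closed => e e0.
(* moving the pole by d changes the product by at most d C / y^2 = e *)
pose d := e * y ^+ 2 / C.
have d0 : 0 < d by rewrite /d divr_gt0// mulr_gt0// exprn_gt0.
have w0 : 0 < y + d by rewrite addr_gt0.
exists (fun u => (y + d + u)^-1 * \prod_(z <- z :: ys) (z + u)^-1).
  by apply: neq => //; rewrite yz gt_eqF// ltrDl.
move=> n i ni; set u := x n i; have u0 : 0 < u by exact: x_gt0.
rewrite -mulrBl normrM [X in _ * X]gtr0_norm; last by rewrite prod_gt0// ltW.
have P_C : \prod_(z <- z :: ys) (z + u)^-1 <= C.
  rewrite /C big_seq [leRHS]big_seq; apply: ler_prod => w wr.
  have w1 : 0 < w by exact: (allP zys0).
  apply/andP; split; first by rewrite invr_ge0 ltW// addr_gt0.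
  by rewrite lef_pV2 ?posrE ?addr_gt0// lerDl ltW.
apply: (@le_trans _ _ (d / y ^+ 2 * C)); last first.
  suff -> : d / y ^+ 2 * C = e by [].
  by rewrite /d; field; rewrite !gt_eqF.
apply: ler_pM => //; first by rewrite ltW// prod_gt0// ltW.
have -> : (y + u)^-1 - (y + d + u)^-1 = d / ((y + u) * (y + d + u)).
  by field; rewrite !gt_eqF ?addr_gt0.
rewrite gtr0_norm; last by rewrite divr_gt0// mulr_gt0 ?addr_gt0.
rewrite ler_pM2l//.
have [yu ydu] : 0 < y + u /\ 0 < y + d + u by rewrite !addr_gt0.
rewrite lef_pV2 ?posrE ?mulr_gt0 ?exprn_gt0// expr2.
by apply: ler_pM; lra.
Qed.

(** The powers of 1 / (1 + u) are products of resolvents with all poles at -1. *)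
Lemma is_cvg_row_mean_poly (p : {poly R}) :
  cvgn (row_mean x (fun u => p.[(1 + u)^-1])).
Proof.
have cst c : cvgn (row_mean x (fun=> c)).
  apply/cvg_ex; exists c; apply: cvg_near_cst; near=> n.
  rewrite /row_mean sumr_const card_ord -[c *+ n]mulr_natl mulKf//.
  by rewrite pnatr_eq0 -lt0n; near: n; exists 1%N.
have pow k : cvgn (row_mean x (fun u => (1 + u)^-1 ^+ k)).
  case: k => [|k]; first exact: cst.
  rewrite (_ : (fun u => _) = (fun u => (1 + u)^-1 * \prod_(z <- nseq k 1) (z + u)^-1)).
    by apply: is_cvg_row_mean_prod_resolvent => //; apply/allP => z /nseqP[->].
  by apply/funext => u; rewrite big_nseq -Monoid.iteropE exprS -[iterop _ _ _ _]/(_ ^+ _).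
have sums N : cvgn (row_mean x (fun u => \sum_(k < N) p`_k * (1 + u)^-1 ^+ k)).
  elim: N => [|N IH].
    by rewrite (_ : (fun u => _) = fun=> 0) //; apply/funext => u; rewrite big_ord0.
  rewrite (_ : (fun u => _) = ((fun u => \sum_(k < N) p`_k * (1 + u)^-1 ^+ k)
    \+ (fun u => p`_N * (1 + u)^-1 ^+ N))).
    by apply: is_cvg_row_mean_add => //; exact: is_cvg_row_mean_scale.
  by apply/funext => u; rewrite big_ord_recr.
rewrite (_ : (fun u => _) = (fun u => \sum_(k < size p) p`_k * (1 + u)^-1 ^+ k)) //.
by apply/funext => u; rewrite horner_coef.
Unshelve. all: by end_near.
Qed.

End RowMean.

(** The polynomial 1 - (1 - v^k)^m is close to 0 where m v^k is small, and close to
    1 where m v^k is large. With m of order c^(-k) for some c between a and b, a large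
    k separates the two regimes. *)
Lemma poly_cutoff (R : realType) (a b e : R) : 0 < a -> a < b -> b <= 1 -> 0 < e ->
  exists p : {poly R}, [/\ forall v : R, 0 <= v <= 1 -> 0 <= p.[v] <= 1,
    forall v : R, 0 <= v <= a -> p.[v] <= e & forall v : R, b <= v <= 1 -> 1 - e <= p.[v]].
Proof.
move=> a0 ab b1 e0.
have [c [ac cb]] : exists c, a < c /\ c < b by exists ((a + b) / 2); lra.
have [b0 c0] : 0 < b /\ 0 < c by lra.
have [k [ka kb]] : exists k, 2 * (a / c) ^+ k <= e /\ expR (- (b / c) ^+ k) <= e.
  have l1 : \forall k \near \oo, 2 * (a / c) ^+ k <= e.
    have : (fun k => (a / c) ^+ k) @ \oo --> (0 : R).
      by apply: cvg_expr; rewrite gtr0_norm ?divr_gt0// ltr_pdivrMr ?mul1r.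
    have e2 : 0 < e / 2 by rewrite divr_gt0.
    by move=> /cvgr_lt /(_ _ e2); apply: filterS => k; lra.
  have l2 : \forall k \near \oo, expR (- (b / c) ^+ k) <= e.
    have : (fun k => (c / b) ^+ k) @ \oo --> (0 : R).
      by apply: cvg_expr; rewrite gtr0_norm ?divr_gt0// ltr_pdivrMr ?mul1r.
    move=> /cvgr_lt /(_ _ e0); apply: filterS => k ck.
    apply: le_trans (ltW ck).
    have bk0 : 0 < (b / c) ^+ k by rewrite exprn_gt0// divr_gt0.
    rewrite expRN -[c / b]invrK invf_div exprVn lef_pV2 ?posrE ?expR_gt0//.
    by apply: le_trans (expR_ge1Dx _); rewrite lerDr.
  by near \oo => k; exists k; split; near: k.
pose m := (Num.truncn (c ^- k)).+1.
have mgt : c ^- k <= m%:R by rewrite ltW// truncnS_gt.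
have mle : m%:R <= 2 * c ^- k.
  rewrite /m -natr1 mulr_natl mulr2n lerD//.
    by rewrite truncn_le invr_ge0 exprn_ge0// ltW.
  by rewrite invf_ge1 ?exprn_gt0// exprn_ile1 ?ltW// (lt_le_trans cb).
exists (1 - (1 - 'X^k) ^+ m).
have pE (v : R) : (1 - (1 - 'X^k) ^+ m).[v] = 1 - (1 - v ^+ k) ^+ m.
  by rewrite !hornerE.
have v01 (v : R) : 0 <= v <= 1 -> 0 <= 1 - v ^+ k <= 1.
  move=> /andP[v0 v1]; have := exprn_ge0 k v0; have := exprn_ile1 k v0 v1; lra.
split=> v.
- move=> /v01 /andP[w0 w1]; rewrite pE.
  have := exprn_ge0 m w0; have := exprn_ile1 m w0 w1; lra.
- move=> /andP[v0 va]; rewrite pE.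
  have va1 : v <= 1 by lra.
  have /andP[w0 w1] : 0 <= 1 - v ^+ k <= 1 by apply: v01; rewrite v0.
  have bern : 1 - m%:R * v ^+ k <= (1 - v ^+ k) ^+ m.
    elim: (m) => [|j IH]; first by rewrite mul0r subr0 expr0.
    rewrite exprS; apply: (@le_trans _ _ ((1 - v ^+ k) * (1 - j%:R * v ^+ k))); last exact: ler_wpM2l.
    rewrite -natr1; have : 0 <= j%:R * (v ^+ k * v ^+ k) by rewrite mulr_ge0// -expr2 sqr_ge0.
    nra.
  have vka : v ^+ k <= a ^+ k by apply: lerXn2r => //; rewrite nnegrE; lra.
  have : m%:R * v ^+ k <= 2 * c ^- k * a ^+ k by rewrite ler_pM// exprn_ge0.
  move: ka; rewrite expr_div_n mulrCA mulrC; lra.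
- move=> /andP[bv v1]; rewrite pE lerD2l lerN2.
  have v0 : 0 <= v by lra.
  have /andP[w0 w1] : 0 <= 1 - v ^+ k <= 1 by apply: v01; rewrite v0.
  apply: le_trans kb.
  apply: (@le_trans _ _ (expR (- v ^+ k) ^+ m)).
    by rewrite lerXn2r ?nnegrE ?expR_ge0// expR_ge1Dx.
  rewrite -expRM_natl ler_expR mulrN lerN2 expr_div_n mulrC.
  have bvk : b ^+ k <= v ^+ k by apply: lerXn2r => //; rewrite nnegrE; lra.
  by rewrite ler_pM// ?invr_ge0 exprn_ge0// ltW.
Unshelve. all: by end_near.
Qed.

Definition infinitely_often (P : nat -> Prop) := forall N, exists2 n, (N <= n)%N & P n.

Lemma not_infinitely_often (P : nat -> Prop) :
  ~ infinitely_often P -> \forall n \near \oo, ~ P n.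
Proof.
move=> /existsNP[N nP]; exists N => // n /= Nn Pn.
by apply: nP; exists n.
Qed.

Lemma infinitely_often_near (P Q : nat -> Prop) :
  infinitely_often P -> (\forall n \near \oo, Q n) -> exists2 n, P n & Q n.
Proof. by move=> iP [N _ NQ]; have [n /NQ Qn Pn] := iP N; exists n. Qed.

Lemma sum_two_values (R : pzRingType) (c d : R) (k n : nat) : (k <= n)%N ->
  \sum_(i < n) (if (i < k)%N then c else d) = k%:R * c + (n - k)%:R * d.
Proof.
move=> kn; rewrite -(big_mkord xpredT (fun i => if (i < k)%N then c else d)).
rewrite (@big_cat_nat _ _ _ k)//= !mulr_natl; congr (_ + _).
  rewrite (eq_big_nat _ _ (F2 := fun=> c)) ?sumr_const_nat ?subn0// => i /andP[_ ->] //.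
rewrite (eq_big_nat _ _ (F2 := fun=> d)) ?sumr_const_nat// => i /andP[+ _].
by rewrite ltnNge => ->.
Qed.

(** For sorted rows this is the quantile function of the empirical measure of row
    n, on [0, 1). *)
Definition row_quantile (R : realType) (x : nat -> nat -> R) (n : nat) (u : R) : R :=
  x n (Num.truncn (n%:R * u)).

(** The upper limit of the quantiles, written as a supremum to make its
    monotonicity in u immediate. *)
Definition limit_quantile (R : realType) (x : nat -> nat -> R) (u : R) : R :=
  sup [set r | infinitely_often (fun n => r < row_quantile x n u)].

Section Quantile.
Context {R : realType} (x : nat -> nat -> R).
Hypothesis x_gt0 : forall n i, (i < n)%N -> 0 < x n i.
Hypothesis x_sorted : forall n i j, (i <= j)%N -> (j < n)%N -> x n i <= x n j.

Lemma truncn_index n (u : R) : (0 < n)%N -> 0 <= u -> u < 1 ->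
  [/\ (Num.truncn (n%:R * u) < n)%N, (Num.truncn (n%:R * u))%:R <= n%:R * u
    & n%:R * u < (Num.truncn (n%:R * u)).+1%:R].
Proof.
move=> n0 u0 u1; have nu : 0 <= n%:R * u by rewrite mulr_ge0.
have /andP[le lt] := truncn_itv nu; split=> //.
by rewrite truncn_lt_nat// gtr_pMr// ltr0n.
Qed.

Lemma row_mean_le_step f (a b : R) n k : (0 < n)%N -> (k <= n)%N ->
  (forall i, (i < k)%N -> f (x n i) <= a) ->
  (forall i, (k <= i < n)%N -> f (x n i) <= b) ->
  row_mean x f n <= n%:R^-1 * (k%:R * a + (n - k)%:R * b).
Proof.
move=> n0 kn fa fb; rewrite /row_mean ler_wpM2l ?invr_ge0//.
rewrite -sum_two_values//; apply: ler_sum => i _.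
by case: ifPn => [ik|]; [exact: fa|rewrite -leqNgt => ki; apply: fb; rewrite ki /=].
Qed.

Lemma le_row_mean_step f (a b : R) n k : (0 < n)%N -> (k <= n)%N ->
  (forall i, (i < k)%N -> a <= f (x n i)) ->
  (forall i, (k <= i < n)%N -> b <= f (x n i)) ->
  n%:R^-1 * (k%:R * a + (n - k)%:R * b) <= row_mean x f n.
Proof.
move=> n0 kn fa fb; rewrite /row_mean ler_wpM2l ?invr_ge0//.
rewrite -sum_two_values//; apply: ler_sum => i _.
by case: ifPn => [ik|]; [exact: fa|rewrite -leqNgt => ki; apply: fb; rewrite ki /=].
Qed.

Hypothesis cvg_poly : forall p : {poly R},
  cvgn (row_mean x (fun u => p.[(1 + u)^-1])).

(** If the quantiles exceed b infinitely often at u and stay below a < b infinitely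
    often at u' > u, then infinitely many rows have at most a fraction u of their
    entries below b, and infinitely many have at least a fraction u' below a. The
    means of a polynomial cutoff between a and b then cannot converge. *)
Lemma row_quantile_separation (u u' a b : R) : 0 <= u -> u < u' -> u' < 1 ->
  infinitely_often (fun n => b < row_quantile x n u) ->
  infinitely_often (fun n => row_quantile x n u' < a) -> b <= a.
Proof.
move=> u0 uu' u'1 iou iou'; rewrite leNgt; apply/negP => ab.
have a0 : 0 < a.
  have [n n0] := iou' 1%N; apply: le_lt_trans; apply/ltW/x_gt0.
  by have [] := @truncn_index n u' n0 (ltW (le_lt_trans u0 uu')) u'1.
have [e [e0 e1 e3]] : exists e, [/\ 0 < e, e < 1 & 3 * e = u' - u].
  by exists ((u' - u) / 3); split; lra.
have [||||p [p01 pa pb]] := @poly_cutoff R (1 + b)^-1 (1 + a)^-1 e => //.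
- by rewrite invr_gt0; lra.
- by rewrite ltf_pV2 ?posrE; lra.
- by rewrite invf_le1; lra.
(* the map u -> 1 / (1 + u) reverses the order, so p is large below a *)
pose f u := p.[(1 + u)^-1].
have v01 n i : (i < n)%N -> 0 <= (1 + x n i)^-1 <= 1.
  move=> /x_gt0 x0; apply/andP; split; first by rewrite invr_ge0; lra.
  by rewrite invf_le1; lra.
have cf : cvgn (row_mean x f) by exact: cvg_poly.
have e2 : 0 < e / 2 by lra.
move/cvgrPdist_lt : cf => /(_ _ e2) cf.
have cf1 : \forall n \near \oo, `|limn (row_mean x f) - row_mean x f n| < e / 2 /\ (0 < n)%N.
  by near=> n; split; [near: n|near: n; exists 1%N].
have [n qn [Ln n0]] := infinitely_often_near iou cf1.
have [m qm [Lm m0]] := infinitely_often_near iou' cf1.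
have nR0 : 0 < n%:R :> R by rewrite ltr0n.
have mR0 : 0 < m%:R :> R by rewrite ltr0n.
have fn : row_mean x f n <= u + e.
  have [kn ku _] := truncn_index n0 u0 (lt_trans uu' u'1).
  move: qn; rewrite /row_quantile; set k := Num.truncn _ in kn ku * => qn.
  apply: (le_trans (@row_mean_le_step f 1 e n k n0 (ltnW kn) _ _)).
  - by move=> i ik; have /andP[] := p01 _ (v01 n i (ltn_trans ik kn)).
  - move=> i /andP[ki i_n]; apply: pa; have /andP[-> _] := v01 _ _ i_n => /=.
    by have xi := x_sorted ki i_n; rewrite lef_pV2 ?posrE; lra.
  - rewrite ler_pdivrMl// natrB ?(ltnW kn)//.
    have : 0 <= k%:R * e by rewrite mulr_ge0// ltW.
    by lra.
have fm : u' - e <= row_mean x f m.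
  have [km _ ku] := truncn_index m0 (ltW (le_lt_trans u0 uu')) u'1.
  move: qm; rewrite /row_quantile; set k := Num.truncn _ in km ku * => qm.
  apply: (le_trans _ (@le_row_mean_step f (1 - e) 0 m k.+1 m0 km _ _)).
  - rewrite ler_pdivlMl// mulr0 addr0.
    apply: (@le_trans _ _ (m%:R * u' * (1 - e))); last by rewrite ler_pM2r; lra.
    by rewrite -mulrA ler_pM2l//; nra.
  - move=> i ik; apply: pb; have /andP[_ ->] := v01 _ _ (leq_trans ik km).
    rewrite andbT; have xi := @x_sorted m i k ik km.
    have xi0 := x_gt0 (leq_trans ik km); by rewrite lef_pV2 ?posrE; lra.
  - by move=> i /andP[_ i_m]; have /andP[] := p01 _ (v01 m i i_m).
move: Ln Lm; rewrite !ltr_norml => /andP[Ln1 Ln2] /andP[Lm1 Lm2]; lra.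
Unshelve. all: by end_near.
Qed.

Hypothesis tight : forall e, 0 < e -> exists2 y, 0 < y &
  \forall n \near \oo, 1 - e < row_mean x (fun u => y / (y + u)) n.

(** If the quantile at u < 1 is at least y, then a fraction 1 - u of the row is at
    least y, where y / (y + x) is at most 1/2; so the mean of y / (y + x) is at most
    (1 + u) / 2. *)
Lemma row_quantile_bounded (u : R) : 0 <= u -> u < 1 ->
  exists M, \forall n \near \oo, row_quantile x n u < M.
Proof.
move=> u0 u1; have [|y y0 ey] := tight (e := (1 - u) / 2); first by lra.
exists y; near=> n.
have n0 : (0 < n)%N by near: n; exists 1%N.
have nR0 : 0 < n%:R :> R by rewrite ltr0n.
rewrite ltNge; apply/negP => qn.
have : 1 - (1 - u) / 2 < row_mean x (fun u => y / (y + u)) n by near: n.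
apply/negP; rewrite -leNgt.
have [kn ku _] := truncn_index n0 u0 u1.
move: qn; rewrite /row_quantile; set k := Num.truncn _ in kn ku * => qn.
apply: (le_trans (@row_mean_le_step _ 1 (2^-1) n k n0 (ltnW kn) _ _)).
- move=> i ik; have := x_gt0 (ltn_trans ik kn) => xi.
  by rewrite ler_pdivrMr; lra.
- move=> i /andP[ki i_n]; have := x_sorted ki i_n => xi.
  by rewrite ler_pdivrMr; lra.
- by rewrite ler_pdivrMl// natrB ?(ltnW kn)//; lra.
Unshelve. all: by end_near.
Qed.

Let levels u : set R := [set r | infinitely_often (fun n => r < row_quantile x n u)].

Lemma has_sup_levels (u : R) : 0 <= u -> u < 1 -> levels u 0 /\ has_sup (levels u).
Proof.
move=> u0 u1.
have l0 : levels u 0.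
  move=> N; exists N.+1 => //; apply: x_gt0.
  by have [] := @truncn_index N.+1 u isT u0 u1.
split=> //; split; first by exists 0.
have [M qM] := row_quantile_bounded u0 u1; exists M => r lr.
by have [n rn nM] := infinitely_often_near lr qM; apply/ltW/(lt_trans rn).
Qed.

Lemma limit_quantile_ge0 (u : R) : 0 <= u -> u < 1 -> 0 <= limit_quantile x u.
Proof.
by move=> u0 u1; have [l0 [_ ub]] := has_sup_levels u0 u1; exact: ub_le_sup.
Qed.

Lemma limit_quantile_homo (u u' : R) : 0 <= u -> u <= u' -> u' < 1 ->
  limit_quantile x u <= limit_quantile x u'.
Proof.
move=> u0 uu' u'1; have u'0 := le_trans u0 uu'; have u1 := le_lt_trans uu' u'1.
have [_ [ne _]] := has_sup_levels u0 u1.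
have [_ [_ ub]] := has_sup_levels u'0 u'1.
apply: ge_sup => // r lr; apply: ub_le_sup => // N.
have [n Nn rn] := lr N.+1; exists n; first exact: ltnW.
have n0 : (0 < n)%N by exact: leq_trans Nn.
apply: (lt_le_trans rn); apply: x_sorted; last by have [] := truncn_index n0 u'0 u'1.
by apply: le_truncn; rewrite ler_wpM2l.
Qed.

(** By [row_quantile_separation] the oscillation intervals of the quantiles at
    different levels do not overlap, and each nondegenerate one contains a rational. *)
Lemma countable_not_cvg_row_quantile :
  countable [set u : R | 0 <= u < 1 /\
    ~ (row_quantile x n u @[n --> \oo] --> limit_quantile x u)].
Proof.
pose gap (u : R) (q : rat) := levels u (ratr q) /\
  exists2 a, a < ratr q & infinitely_often (fun n => row_quantile x n u < a).
have gapP (u : R) : 0 <= u -> u < 1 ->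
    ~ (row_quantile x n u @[n --> \oo] --> limit_quantile x u) -> exists q, gap u q.
  move=> u0 u1 /cvgrPdist_lt /existsNP[e /not_implyP[e0 nce]].
  have [l0 hs] := has_sup_levels u0 u1.
  set L := limit_quantile x u in nce *.
  have eu : \forall n \near \oo, row_quantile x n u <= L + e / 2.
    have : ~ levels u (L + e / 2).
      move=> /ub_le_sup; rewrite -/(limit_quantile x u) -/L => /(_ hs.2).
      by lra.
    by move=> /not_infinitely_often; apply: filterS => n /negP; rewrite -leNgt.
  have il : infinitely_often (fun n => row_quantile x n u <= L - e).
    apply: contrapT => /not_infinitely_often nl; apply: nce.
    near=> n.
    have h1 : row_quantile x n u <= L + e / 2 by near: n.
    have /negP : ~ (row_quantile x n u <= L - e) by near: n.
    by rewrite -ltNge ltr_norml; lra.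
  have [r lr rL] : exists2 r, levels u r & L - e / 2 < r.
    by apply: sup_adherent => //; lra.
  have [q] := @rat_in_itvoo R (L - e / 2) r rL; rewrite in_itv/= => /andP[q1 q2].
  exists q; split.
    by move=> N; have [n Nn rn] := lr N; exists n => //; exact: lt_trans rn.
  exists (L - e / 2) => // N; have [n Nn nL] := il N; exists n => //.
  by apply: le_lt_trans nL _; lra.
pose r u := xget 0 [set q | gap u q].
apply/countable_injP; exists (fun u => pickle (r u)) => u u'.
rewrite !inE/= => -[/andP[u0 u1] nu] [/andP[u'0 u'1] nu'].
move=> /(pcan_inj pickleK) ruu'.
have gu : gap u (r u).
  by have [q gq] := gapP u u0 u1 nu; exact: (xgetPex 0 (ex_intro _ q gq)).
have gu' : gap u' (r u').
  by have [q gq] := gapP u' u'0 u'1 nu'; exact: (xgetPex 0 (ex_intro _ q gq)).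
have disj (v v' : R) : 0 <= v -> v < v' -> v' < 1 ->
    gap v (r v) -> gap v' (r v') -> r v = r v' -> False.
  move=> v0 vv' v'1 [lv _] [_ [a ar ia]] rr; move: ar; rewrite -rr.
  by apply/negP; rewrite -leNgt; exact: (row_quantile_separation v0 vv' v'1 lv).
have [uu'|uu'|//] := ltgtP u u'; exfalso.
- exact: (disj _ _ u0 uu' u'1).
- exact: (disj _ _ u'0 uu' u1 gu' gu (esym ruu')).
Unshelve. all: by end_near.
Qed.

End Quantile.

(** Monotonicity is asked on D only, because the upper limit of the quantiles at u
    may be infinite for u outside [0, 1). *)
Lemma homo_interval_measurable (R : realType) (D : set R) (f : R -> R) :
  measurable D -> is_interval D ->
  (forall s t, D s -> D t -> s <= t -> f s <= f t) -> measurable_fun D f.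
Proof.
move=> mD iD fD.
apply: (measurability (@RGenCInfty.G R)) => [|/= _ [_] [r] -> <-].
  exact: RGenCInfty.measurableE.
apply: is_interval_measurable => s t/=.
rewrite !in_itv/= !andbT => -[Ds fs] [Dt ft] u /andP[su ut].
have Du : D u by apply: (iD s t) => //; rewrite su ut.
by split=> //; rewrite in_itv/= andbT (le_trans fs)// fD.
Qed.

Lemma integrable_bounded d (T : measurableType d) (R : realType)
    (P : probability T R) (f : T -> R) : measurable_fun setT f ->
  (exists M, forall u, `|f u| <= M) -> P.-integrable setT (EFin \o f).
Proof.
move=> mf [M fM]; apply: measurable_bounded_integrable => //.
  by apply: (@le_lt_trans _ _ 1%E); rewrite ?ltry// probability_le1.
by exists M; split; [exact: num_real|move=> r Mr u _ /=; exact: le_trans (ltW Mr)].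
Qed.

Section Uniform.
Context {R : realType}.

Definition unit_prob : probability (measurableTypeR R) R := uniform_prob (@ltr01 R).

Definition cell (n i : nat) : set R := `[i%:R / n%:R, i.+1%:R / n%:R[%classic.

Lemma measurable_cell n i : measurable (cell n i : set (measurableTypeR R)).
Proof. exact: measurable_itv. Qed.

Lemma lebesgue_cell n i : (i < n)%N ->
  lebesgue_measure (cell n i) = (n%:R^-1)%:E.
Proof.
move=> i_n; have n0 : 0 < n%:R :> R by rewrite ltr0n (leq_ltn_trans _ i_n).
rewrite lebesgue_measure_itv/= lte_fin ltr_pM2r ?invr_gt0// ltr_nat ltnSn.
by rewrite -EFinB -mulrBl -natr1 addrAC subrr add0r mul1r.
Qed.

Lemma unit_prob_cell n i : (i < n)%N -> unit_prob (cell n i) = (n%:R^-1)%:E.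
Proof.
move=> i_n; have n0 : 0 < n%:R :> R by rewrite ltr0n (leq_ltn_trans _ i_n).
rewrite /unit_prob/= /uniform_prob.
rewrite (eq_integral (fun=> 1%E)); last first.
  move=> u; rewrite inE /cell/= in_itv/= => /andP[iu ui].
  rewrite /uniform_pdf subr0 invr1 ifT//.
  rewrite (le_trans _ iu) ?divr_ge0//= (le_trans (ltW ui))// ler_pdivrMr// mul1r.
  by rewrite ler_nat.
rewrite integral_cst ?mul1e; last exact: measurable_cell.
exact: lebesgue_cell.
Qed.

Lemma ae_unit_prob (P : R -> Prop) (A : set R) : countable A ->
  (forall u, 0 <= u < 1 -> ~ A u -> P u) -> {ae unit_prob, forall u, P u}.
Proof.
move=> cA AP.
have mA : measurable (A : set (measurableTypeR R)) by exact: countable_measurable.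
exists (A `|` ~` cell 1 0); split.
- by apply: measurableU => //; apply: measurableC; exact: measurable_cell.
- have A0 : unit_prob A = 0%E.
    have /null_content_dominatesP := @dominates_uniform_prob R _ _ (@ltr01 R).
    by apply => //; exact: countable_lebesgue_measure0.
  rewrite measureU0//; first exact: measurableC (measurable_cell _ _).
  have := probability_setC unit_prob (measurable_cell 1 0).
  by rewrite unit_prob_cell// invr1 subee.
- move=> u /= nPu; apply: contrapT => /not_orP[nA /contrapT].
  rewrite /cell/= in_itv/= mul0r divr1 => u01; exact/nPu/AP.
Qed.

(** Agrees with f composed with the n-th quantile function on [0, 1), in a form
    whose measurability and integral are immediate. *)
Definition step_fun (x : nat -> nat -> R) (f : R -> R) (n : nat) (u : measurableTypeR R) : R :=
  \sum_(i < n) f (x n i) * \1_(cell n i) u.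

Lemma measurable_step_fun x f n : measurable_fun setT (step_fun x f n).
Proof.
apply: measurable_sum => i; apply: measurable_funM => //.
by apply: measurable_indic; exact: measurable_cell.
Qed.

Lemma step_funE x f n (u : R) : (0 < n)%N -> 0 <= u -> u < 1 ->
  step_fun x f n u = f (row_quantile x n u).
Proof.
move=> n0 u0 u1; have [kn ku uk] := truncn_index n0 u0 u1.
have nR0 : 0 < n%:R :> R by rewrite ltr0n.
rewrite /step_fun /row_quantile (bigD1 (Ordinal kn))//= big1 ?addr0.
  rewrite indicE mem_set ?mulr1// /cell/= in_itv/=.
  by rewrite ler_pdivrMr// ltr_pdivlMr// !(mulrC u) ku uk.
move=> i /eqP ik; rewrite indicE memNset ?mulr0// /cell/= in_itv/=.
rewrite ler_pdivrMr// ltr_pdivlMr// !(mulrC u) => iu; apply: ik; apply/val_inj => /=.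
by apply/esym/truncn_def.
Qed.

Lemma le_step_fun x f n (u : R) (M : R) : (forall v, `|f v| <= M) ->
  0 <= u -> u < 1 -> `|step_fun x f n u| <= M.
Proof.
move=> fM u0 u1; case: n => [|n]; last by rewrite step_funE.
by rewrite /step_fun big_ord0 normr0 (le_trans _ (fM 0)).
Qed.

Lemma integrable_indic_cell n i (c : R) :
  unit_prob.-integrable setT (EFin \o (fun u => c * \1_(cell n i) u)).
Proof.
apply: integrable_bounded.
  by apply: measurable_funM => //; apply: measurable_indic; exact: measurable_cell.
exists `|c| => u; rewrite normrM ler_piMr// indicE normr_nat.
by case: (_ \in _).
Qed.

Lemma integrable_sum_cell n k (c : nat -> R) :
  unit_prob.-integrable setT (EFin \o (fun u => \sum_(i < k) c i * \1_(cell n i) u)).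
Proof.
elim: k => [|k IH].
  rewrite (_ : (fun u => _) = fun=> 0); last by apply/funext => u; rewrite big_ord0.
  by apply: integrable_bounded => //; exists 0 => u; rewrite normr0.
rewrite (_ : _ \o _ = (EFin \o (fun u => \sum_(i < k) c i * \1_(cell n i) u))
    \+ (EFin \o (fun u => c k * \1_(cell n k) u))).
  by apply: integrableD => //; exact: integrable_indic_cell.
by apply/funext => u; rewrite /= big_ord_recr.
Qed.

Lemma integrable_step_fun x f n : unit_prob.-integrable setT (EFin \o step_fun x f n).
Proof. exact: (@integrable_sum_cell n n (fun i => f (x n i))). Qed.

Lemma Rintegral_step_fun x f n :
  (\int[unit_prob]_u step_fun x f n u)%R = row_mean x f n.
Proof.
have cellE i (c : R) : (i < n)%N -> (\int[unit_prob]_u (c * \1_(cell n i) u))%R = c / n%:R.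
  move=> i_n; rewrite RintegralZl//; last first.
    by have := integrable_indic_cell n i 1; under eq_fun do rewrite /= mul1r.
  rewrite /Rintegral integral_indic//; last exact: measurable_cell.
  by rewrite setIT [X in fine X]unit_prob_cell.
rewrite /row_mean mulrC mulr_suml.
pose F k (u : measurableTypeR R) := \sum_(i < k) f (x n i) * \1_(cell n i) u.
have FS k : F k.+1 = (fun u => F k u + f (x n k) * \1_(cell n k) u).
  by apply/funext => u; rewrite /F big_ord_recr.
have iF k : unit_prob.-integrable setT (EFin \o F k).
  exact: (@integrable_sum_cell n k (fun i => f (x n i))).
suff H k : (k <= n)%N -> (\int[unit_prob]_u F k u)%R = \sum_(i < k) f (x n i) / n%:R.
  by rewrite -H.
elim: k => [_|k IH kn].
  rewrite big_ord0 -[RHS](_ : (\int[unit_prob]_(u in setT) 0)%R = 0); last first.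
    by rewrite Rintegral_cst// mul0r.
  by apply: eq_Rintegral => u _; rewrite /F big_ord0.
rewrite FS RintegralD//; last exact: integrable_indic_cell.
by rewrite IH ?(ltnW kn)// big_ord_recr/= cellE.
Qed.

End Uniform.

Section LimitLaw.
Context {R : realType} (x : nat -> nat -> R).
Hypothesis x_gt0 : forall n i, (i < n)%N -> 0 < x n i.
Hypothesis x_sorted : forall n i j, (i <= j)%N -> (j < n)%N -> x n i <= x n j.
Hypothesis cvg_resolvent : forall y, 0 < y ->
  cvgn (row_mean x (fun u => (y + u)^-1)).
Hypothesis tight : forall e, 0 < e -> exists2 y, 0 < y &
  \forall n \near \oo, 1 - e < row_mean x (fun u => y / (y + u)) n.

(** The limit law is the image of the uniform distribution under the limit
    quantile. Quantile functions of the rows converge to it almost everywhere, so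
    dominated convergence applies to every bounded continuous f at once. *)
Theorem exists_weak_limit : exists nu : probability (measurableTypeR R) R,
  nu `[0, +oo[%classic = 1%E /\
  forall f : R -> R, continuous f -> (exists M, forall u, `|f u| <= M) ->
    row_mean x f @ \oo --> (\int[nu]_u f u)%R.
Proof.
pose X : measurableTypeR R -> measurableTypeR R :=
  limit_quantile x \_ (cell 1 0).
have cellP u : cell 1 0 u = (0 <= u < 1) :> Prop.
  by rewrite /cell/= in_itv/= mul0r divr1.
have XE u : 0 <= u < 1 -> X u = limit_quantile x u.
  by move=> u01; rewrite /X patchE mem_set// cellP.
have mX : measurable_fun setT X.
  apply/(measurable_restrictT _ _).1; first exact: measurable_cell.
  apply: homo_interval_measurable; first exact: measurable_cell.
    exact: interval_is_interval.
  move=> s t; rewrite !cellP => /andP[s0 s1] /andP[t0 t1] st.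
  exact: (limit_quantile_homo x_gt0 x_sorted tight).
have X0 u : 0 <= X u.
  rewrite /X patchE; case: ifPn => // /set_mem; rewrite cellP => /andP[u0 u1].
  exact: (limit_quantile_ge0 x_gt0 x_sorted tight).
pose X' : {mfun measurableTypeR R >-> measurableTypeR R} :=
  HB.pack X (isMeasurableFun.Build _ _ _ _ X mX).
exists (distribution unit_prob X'); split.
  rewrite /distribution/= /pushforward (_ : _ @^-1` _ = setT).
    exact: probability_setT.
  by apply/seteqP; split => // u _; rewrite /= in_itv/= andbT X0.
move=> f cf [M fM].
have mf : measurable_fun setT f by exact: continuous_measurable_fun.
have mfX : measurable_fun setT (f \o X) by exact: measurableT_comp.
have -> : (\int[distribution unit_prob X']_u f u = \int[unit_prob]_u f (X u))%R.
  rewrite /Rintegral integral_distribution//; first exact/measurable_EFinP.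
  by apply: integrable_bounded => //; exists M => u; exact: fM.
have M0 : 0 <= M by apply: le_trans (fM 0).
pose bad := [set u : R | 0 <= u < 1 /\
    ~ (row_quantile x n u @[n --> \oo] --> limit_quantile x u)].
have bad0 : countable bad.
  by apply: countable_not_cvg_row_quantile => //; exact: is_cvg_row_mean_poly.
have [|||||ifX _] := @dominated_convergence _ _ _ unit_prob setT measurableT
  (fun n => EFin \o step_fun x f n) (EFin \o (f \o X)) (EFin \o (fun=> M)).
- by move=> n; apply/measurable_EFinP; exact: measurable_step_fun.
- exact/measurable_EFinP.
- apply: (ae_unit_prob bad0) => u u01 nbad _.
  have qu : row_quantile x n u @[n --> \oo] --> limit_quantile x u.
    by apply: contrapT => nq; apply: nbad.
  apply: cvg_EFin; first by near=> n.
  rewrite /= XE//; have /andP[u0 u1] := u01.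
  apply: (@cvg_trans _ (f (row_quantile x n u) @[n --> \oo])).
    apply: near_eq_cvg; near=> n; rewrite /= step_funE//.
    by near: n; exists 1%N.
  exact: (continuous_cvg _ (cf _)).
- by apply: integrable_bounded => //; exists M => _; rewrite ger0_norm.
- apply: (ae_unit_prob (countable0 R)) => u /andP[u0 u1] _ n _.
  by rewrite /= lee_fin; exact: le_step_fun.
have <- : fine (\int[unit_prob]_u (EFin \o (f \o X)) u)%E = (\int[unit_prob]_u f (X u))%R by [].
rewrite -[X in X @ \oo --> _ -> _](_ : (fun n => (row_mean x f n)%:E) = _).
  by rewrite -[X in _ --> X -> _]fineK ?integrable_fin_num// => /fine_cvg.
apply/funext => n; rewrite /= -Rintegral_step_fun /Rintegral fineK//.
by apply: integrable_fin_num => //; exact: integrable_step_fun.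
Unshelve. all: by end_near.
Qed.

End LimitLaw.

(** * Asymptotics of the resolvent means of the zeros *)

Section Asymptotics.
Context {R : realType}.
Implicit Types (s x y v : R) (n k : nat).

(** Ratio of consecutive coefficients: (k + 1) c_(k+1) and (n - k) c_k differ by the
    factor - q^(n - 2k - 1), whose dependence on k is a rescaling of x by q^2. *)
Lemma Gpoly_deriv n s x :
  Gq s ^+ n * (x * (Gpoly n s)^`().[x] - n%:R * (Gpoly n s).[x]) =
  Gq s * (Gpoly n s)^`().[Gq s ^+ 2 * x].
Proof.
have dE z : (Gpoly n s)^`().[z] = \sum_(k < n.+1) (k.+1%:R * Gcoef n s k.+1) * z ^+ k.
  rewrite (@horner_coef_wide _ n.+1); last first.
    by rewrite (leq_trans (size_poly _ _))// size_Gpoly.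
  apply: eq_bigr => k _; congr (_ * _); rewrite coef_deriv Gpoly_poly coef_poly.
  case: ltnP => kn; first by rewrite mulr_natl.
  by rewrite mul0rn Gcoef_out ?mulr0.
have xdE : x * (Gpoly n s)^`().[x] = \sum_(k < n.+1) k%:R * Gcoef n s k * x ^+ k.
  rewrite dE mulr_sumr big_ord_recr/= Gcoef_out// mulr0 mul0r mulr0 addr0.
  rewrite [RHS]big_ord_recl/= mul0r mul0r add0r; apply: eq_bigr => k _.
  by rewrite /bump/= add1n exprS; ring.
rewrite xdE dE horner_Gpoly !mulr_sumr -sumrB mulr_sumr.
apply: eq_bigr => k _; have kn := ltn_ord k; rewrite ltnS in kn.
move: kn; rewrite leq_eqVlt => /predU1P[->|kn].
  by rewrite (@Gcoef_out _ n s n.+1)//; ring.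
rewrite !GcoefE [k.+1%:R * _](_ : _ =
    (n - k)%:R * 'C(n, k)%:R * ((-1) ^+ (n - k.+1) *  Gq s ^+ (k.+1 * (n - k.+1)))); last first.
  by rewrite -natrM -mul_bin_left natrM; ring.
rewrite natrB ?(ltnW kn)//.
have -> : (n - k = (n - k.+1).+1)%N by rewrite subnSK.
rewrite exprMn -exprM.
have E : Gq s * (Gq s ^+ (k.+1 * (n - k.+1)) * Gq s ^+ (2 * k)) =
    Gq s ^+ n * Gq s ^+ (k * (n - k.+1).+1).
  rewrite -!exprD -exprS; congr (_ ^+ _).
  have : n = (k.+1 + (n - k.+1))%N by rewrite subnKC.
  by move: (n - k.+1)%N (nat_of_ord k) => d j; nia.
have -> : Gq s ^+ n * (k%:R * ((-1) ^+ (n - k.+1).+1 * 'C(n, k)%:R *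
      Gq s ^+ (k * (n - k.+1).+1)) * x ^+ k - n%:R * ((-1) ^+ (n - k.+1).+1 * 'C(n, k)%:R *
      Gq s ^+ (k * (n - k.+1).+1) * x ^+ k)) =
   (Gq s ^+ n * Gq s ^+ (k * (n - k.+1).+1)) * ((n%:R - k%:R) * 'C(n, k)%:R * (-1) ^+ (n - k.+1) * x ^+ k).
  by rewrite exprS; ring.
rewrite -E; ring.
Qed.

Lemma deriv_prod_XsubC n (r : nat -> R) x : (forall i, (i < n)%N -> x != r i) ->
  (\prod_(i < n) ('X - (r i)%:P))^`().[x] =
  \prod_(i < n) (x - r i) * \sum_(i < n) (x - r i)^-1.
Proof.
elim: n => [|n IH] xr; first by rewrite !big_ord0 derivC hornerC mulr0.
rewrite !big_ord_recr/= derivM derivXsubC mulr1 hornerD hornerM IH; last first.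
  by move=> i i_n; rewrite xr// ltnW.
rewrite hornerXsubC horner_prod.
under [X in _ + X = _]eq_bigr do rewrite hornerXsubC.
by field; rewrite subr_eq0 xr.
Qed.

(** Equals y/n times the logarithmic derivative of prod_i (y + r_i). *)
Definition resolvent_mean n (r : nat -> R) y : R := n%:R^-1 * \sum_(i < n) y / (y + r i).

(** [Gpoly_deriv] at x = - t y, divided by G_n(- y). *)
Lemma Gpoly_ratio n s r y : (0 < n)%N -> 0 < y -> mesh_zeros n s r ->
  let t := Gq s ^- 2 in
  resolvent_mean n r y = y * Gq s ^+ n.-1 * (1 - resolvent_mean n r (t * y)) *
    \prod_(i < n) ((t * y + r i) / (y + r i)).
Proof.
move=> n0 y0 mr t; have [r0 _ Gr] := mr.
have q0 := Gq_gt0 s; set q := Gq s in q0 t *.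
have t0 : 0 < t by rewrite invr_gt0 exprn_gt0.
have nR0 : n%:R != 0 :> R by rewrite pnatr_eq0 -lt0n.
have dG z : 0 < z -> (Gpoly n s)^`().[- z] = - (Gpoly n s).[- z] * n%:R * resolvent_mean n r z / z.
  move=> z0; have zr i : (i < n)%N -> - z != r i.
    by move=> /r0 ri; rewrite lt_eqF//; lra.
  rewrite Gr deriv_prod_XsubC// -Gr (horner_mesh_zeros _ mr) /resolvent_mean.
  rewrite -mulr_sumr [X in _ = X](_ : _ =
      - \prod_(i < n) (- z - r i) * \sum_(i < n) (z + r i)^-1); last first.
    by field; rewrite nR0 gt_eqF.
  rewrite mulNr -mulrN; congr (_ * _); rewrite -sumrN; apply: eq_bigr => i _.
  by rewrite -opprD invrN.
have G0 z : 0 < z -> (Gpoly n s).[- z] = (-1) ^+ n * \prod_(i < n) (z + r i).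
  move=> z0; rewrite (horner_mesh_zeros _ mr) -[in (-1) ^+ n](card_ord n).
  by rewrite -prodrN; apply: eq_bigr => i _; rewrite opprD.
have P0 z : 0 < z -> \prod_(i < n) (z + r i) != 0.
  by move=> z0; rewrite gt_eqF// prodr_gt0// => i _; rewrite addr_gt0// r0.
have := Gpoly_deriv n s (- (t * y)); rewrite -/q.
have -> : q ^+ 2 * - (t * y) = - y by rewrite mulrN mulrA mulfV ?mul1r// gt_eqF// exprn_gt0.
have ty0 : 0 < t * y by rewrite mulr_gt0.
rewrite !dG// !G0// prodf_div => E.
move: (P0 _ y0) (P0 _ ty0) E.
set A := \prod_(i < n) (y + _); set B := \prod_(i < n) _ => A0 B0.
set m := resolvent_mean n r y; set m' := resolvent_mean n r (t * y) => E.
have s0 : (-1) ^+ n != 0 :> R by rewrite signr_eq0.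
have E1 : q ^+ n * B * (1 - m') = q * A * m / y.
  apply: (mulfI (_ : - ((-1) ^+ n * n%:R) != 0)); first by rewrite oppr_eq0 mulf_neq0.
  move: E; rewrite [X in X = _](_ : _ = - ((-1) ^+ n * n%:R) * (q ^+ n * B * (1 - m'))); last first.
    by field; rewrite !gt_eqF.
  by move=> ->; field; rewrite gt_eqF.
move: E1; rewrite -{1}(prednK n0) exprS => E1.
apply: (mulfI (_ : q * A / y != 0)).
  by rewrite mulf_neq0 ?invr_eq0 ?mulf_neq0// gt_eqF.
transitivity (q * A * m / y); first by ring.
by rewrite -E1; field; rewrite A0 gt_eqF.
Qed.

End Asymptotics.

Section Asymptotics.
Context {R : realType}.
Implicit Types (s x y v : R) (n k : nat).

Lemma resolvent_mean01 n (r : nat -> R) y : (0 < n)%N -> (forall i, (i < n)%N -> 0 < r i) ->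
  0 < y -> 0 <= resolvent_mean n r y <= 1.
Proof.
move=> n0 r0 y0; have nR0 : 0 < n%:R :> R by rewrite ltr0n.
apply/andP; split.
  rewrite mulr_ge0 ?invr_ge0// sumr_ge0// => i _.
  by rewrite divr_ge0 ?ltW// addr_gt0// r0.
rewrite ler_pdivrMl// mulr1.
apply: (@le_trans _ _ (\sum_(i < n) (1 : R))); last by rewrite sumr_const card_ord.
apply: ler_sum => i _; have ri := r0 i (ltn_ord i).
by rewrite ler_pdivrMr; lra.
Qed.

Lemma resolvent_mean_scale n (r : nat -> R) t y : (forall i, (i < n)%N -> 0 < r i) ->
  0 < t <= 1 -> 0 < y ->
  t * resolvent_mean n r y <= resolvent_mean n r (t * y) <= resolvent_mean n r y.
Proof.
move=> r0 /andP[t0 t1] y0; rewrite /resolvent_mean mulrCA.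
have ty0 : 0 < t * y by rewrite mulr_gt0.
have tyy : t * y <= y by rewrite ler_piMl// ltW.
apply/andP; split; rewrite ler_wpM2l ?invr_ge0//.
  rewrite mulr_sumr; apply: ler_sum => i _; have ri := r0 i (ltn_ord i).
  rewrite mulrA ler_pM2l// lef_pV2 ?posrE; lra.
apply: ler_sum => i _; have ri := r0 i (ltn_ord i).
rewrite ler_pdivrMr; last by lra.
rewrite mulrAC ler_pdivlMr; last by lra.
by nra.
Qed.

(** Both bounds come from 1 + a <= exp(a): the factor equals 1 - (1 - t) p with
    p = y / (y + r_i), and its inverse is at most 1 + (1/t - 1) p. *)
Lemma ratio_prod_bounds n (r : nat -> R) t y : (0 < n)%N -> (forall i, (i < n)%N -> 0 < r i) ->
  0 < t <= 1 -> 0 < y ->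
  expR (- ((t^-1 - 1) * n%:R * resolvent_mean n r y)) <=
  \prod_(i < n) ((t * y + r i) / (y + r i)) <=
  expR (- ((1 - t) * n%:R * resolvent_mean n r y)).
Proof.
move=> n0 r0 /andP[t0 t1] y0.
have nR0 : n%:R != 0 :> R by rewrite pnatr_eq0 -lt0n.
have ty0 : 0 < t * y by rewrite mulr_gt0.
have tyy : t * y <= y by rewrite ler_piMl// ltW.
have expE c : expR (c * n%:R * resolvent_mean n r y) = \prod_(i < n) expR (c * (y / (y + r i))).
  by rewrite -expR_sum /resolvent_mean -mulrA mulVKf// mulr_sumr.
apply/andP; split.
  rewrite expRN expE -prodfV; apply: ler_prod => i _; have ri := r0 i (ltn_ord i).
  rewrite invr_ge0 expR_ge0/= -[leRHS]invf_div lef_pV2 ?posrE ?expR_gt0//; last first.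
    by rewrite divr_gt0; lra.
  apply: le_trans (expR_ge1Dx _).
  rewrite ler_pdivrMr; last by lra.
  rewrite [leRHS](_ : _ = y + r i + (1 - t) * (1 - t) * y * r i / (t * (y + r i))).
    have t10 : 0 <= 1 - t by lra.
    by rewrite lerDl divr_ge0 ?mulr_ge0//; lra.
  by field; rewrite !gt_eqF//; lra.
rewrite -!mulNr expE; apply: ler_prod => i _; have ri := r0 i (ltn_ord i).
apply/andP; split; first by rewrite divr_ge0; lra.
apply: le_trans (expR_ge1Dx _).
rewrite le_eqVlt; apply/orP; left; apply/eqP; field.
by rewrite gt_eqF//; lra.
Qed.

(** As n grows, d tends to 0 and both sides become the same decreasing function of
    m. The factor q^(n-1) is exp(v/2 - d/2). *)
Lemma resolvent_mean_bounds n v r y : (0 < n)%N -> 0 < v -> 0 < y -> mesh_zeros n (v / n%:R) r ->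
  let d := v / n%:R in let m := resolvent_mean n r y in
  y * expR (v / 2 - d / 2) * (1 - m) * expR (- (v * expR d * m)) <= m /\
  m <= y * expR (v / 2 - d / 2) * (1 - expR (- d) * m) * expR (- (v * expR (- d) * m)).
Proof.
move=> n0 v0 y0 mr d m; have [r0 _ _] := mr.
have nR0 : 0 < n%:R :> R by rewrite ltr0n.
have d0 : 0 < d by rewrite divr_gt0.
have tE : Gq d ^- 2 = expR (- d).
  by rewrite /Gq -expRM_natl -expRN; congr expR; field.
have qE : Gq d ^+ n.-1 = expR (v / 2 - d / 2).
  rewrite /Gq -expRM_natl; congr expR; rewrite -subn1 natrB// /d.
  by field; rewrite gt_eqF.
have := Gpoly_ratio n0 y0 mr; rewrite /= -/d tE qE -/m.
set t := expR (- d); set m' := resolvent_mean n r (t * y); set P := \prod_(i < n) _.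
have t01 : 0 < t <= 1 by rewrite expR_gt0 -expR0 ler_expR; lra.
have /andP[tm mm] := resolvent_mean_scale r0 t01 y0.
have /andP[P1 P2] := ratio_prod_bounds n0 r0 t01 y0.
have /andP[m0 m1] := resolvent_mean01 n0 r0 y0.
have ty0 : 0 < t * y by rewrite mulr_gt0 ?expR_gt0.
have /andP[m'0 m'1] := resolvent_mean01 n0 r0 ty0.
rewrite -/m -/m' -/P in tm mm P1 P2 m0 m1 m'0 m'1.
have c0 : 0 <= y * expR (v / 2 - d / 2) by rewrite mulr_ge0 ?expR_ge0 ?ltW.
have dn : d * n%:R = v by rewrite /d divfK// gt_eqF.
have b1 : (1 - t) * n%:R >= v * t.
  rewrite -dn mulrAC ler_pM2r//.
  have := expR_ge1Dx d; rewrite -[expR d]invrK -expRN -/t => td.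
  have t0 : 0 < t by rewrite expR_gt0.
  have : t * (1 + d) <= t * t^-1 by rewrite ler_pM2l.
  by rewrite mulfV ?gt_eqF//; lra.
have b2 : (t^-1 - 1) * n%:R <= v * expR d.
  rewrite -dn mulrAC ler_pM2r// -expRN opprK.
  have := expR_ge1Dx (- d) => td.
  have e0 : 0 < expR d by rewrite expR_gt0.
  have : expR d * (1 - d) <= expR d * expR (- d) by rewrite ler_pM2l.
  by rewrite expRN mulfV ?gt_eqF//; lra.
move=> mE; rewrite -/m in mE; split.
  rewrite [leRHS]mE; apply: ler_pM; rewrite ?expR_ge0//.
  - by rewrite mulr_ge0// subr_ge0.
  - by rewrite ler_wpM2l// lerB.
  - by apply: le_trans P1; rewrite ler_expR lerN2 ler_wpM2r.
rewrite [leLHS]mE; apply: ler_pM.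
- by rewrite mulr_ge0// subr_ge0.
- by apply: le_trans P1; exact: expR_ge0.
- by rewrite ler_wpM2l// lerB.
- by apply: (le_trans P2); rewrite ler_expR lerN2 ler_wpM2r.
Qed.

Section Limit.
Variables (v : R) (x : nat -> nat -> R).
Hypothesis v0 : 0 < v.
Hypothesis xP : forall n, (0 < n)%N -> mesh_zeros n (v / n%:R) (x n).

(** If m_n were at least s + e, then by monotonicity the upper bound of
    [resolvent_mean_bounds] at s + e would be at least s + e; but it converges to a value
    below s. The case m_n <= s - e is symmetric. *)
Lemma cvg_resolvent_mean (s : R) : 0 < s -> s < 1 ->
  row_mean x (fun u => (s / (1 - s) * expR (v * (s - 1 / 2))) /
    (s / (1 - s) * expR (v * (s - 1 / 2)) + u)) n @[n --> \oo] --> s.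
Proof.
move=> s0 s1; set y := s / (1 - s) * _.
have y0 : 0 < y by rewrite mulr_gt0 ?expR_gt0// divr_gt0; lra.
have d0 : v / n%:R @[n --> \oo] --> (0 : R).
  rewrite -[X in _ --> X](mulr0 v); apply: cvgM; first exact: cvg_cst.
  by rewrite -(cvg_shiftS (fun n => n%:R^-1 : R)); exact: cvg_harmonic.
have exp_cvg (u : nat -> R) l : u n @[n --> \oo] --> l -> expR (u n) @[n --> \oo] --> expR l.
  by move=> ul; apply: continuous_cvg => //; exact: continuous_expR.
have e1 : expR (- (v / n%:R)) @[n --> \oo] --> (1 : R).
  have : expR (- (v / n%:R)) @[n --> \oo] --> expR (- 0 : R).
    by apply: exp_cvg; exact: cvgN.
  by rewrite oppr0 expR0.
have e1' : expR (v / n%:R) @[n --> \oo] --> (1 : R).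
  by have := exp_cvg _ _ d0; rewrite expR0.
have ed (w : R) : v * expR (- (v / n%:R)) * w @[n --> \oo] --> v * w.
  have : v * expR (- (v / n%:R)) * w @[n --> \oo] --> v * 1 * w.
    by apply: cvgM; [apply: cvgM; [exact: cvg_cst|exact: e1]|exact: cvg_cst].
  by rewrite mulr1.
have ed' (w : R) : v * expR (v / n%:R) * w @[n --> \oo] --> v * w.
  have : v * expR (v / n%:R) * w @[n --> \oo] --> v * 1 * w.
    by apply: cvgM; [apply: cvgM; [exact: cvg_cst|exact: e1']|exact: cvg_cst].
  by rewrite mulr1.
have c_cvg : y * expR (v / 2 - (v / n%:R) / 2) @[n --> \oo] --> y * expR (v / 2).
  apply: cvgM; first exact: cvg_cst.
  have : v / 2 - v / n%:R / 2 @[n --> \oo] --> v / 2 - 0 / 2.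
    by apply: cvgB; [exact: cvg_cst|apply: cvgM => //; exact: cvg_cst].
  by rewrite mul0r subr0; exact: exp_cvg.
have ysE : y * expR (v / 2) * (1 - s) * expR (- (v * s)) = s.
  have E : expR (v * (s - 1 / 2)) * expR (v / 2) * expR (- (v * s)) = 1.
    by rewrite -!expRD [X in expR X](_ : _ = 0) ?expR0 //; field.
  transitivity (s / (1 - s) * (1 - s) *
    (expR (v * (s - 1 / 2)) * expR (v / 2) * expR (- (v * s)))); first by rewrite /y; ring.
  by rewrite E mulr1 divfK// gt_eqF//; lra.
have ce0 : 0 < y * expR (v / 2) by rewrite mulr_gt0 ?expR_gt0.
apply/cvgrPdist_lt => e e0; have ve0 : 0 < v * e by rewrite mulr_gt0.
near=> n.
have n0 : (0 < n)%N by near: n; exists 1%N.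
have [Lm Um] := resolvent_mean_bounds n0 v0 y0 (xP n0).
have [r0 _ _] := xP n0.
have /andP[m0 m1] := resolvent_mean01 n0 r0 y0.
rewrite (_ : row_mean _ _ _ = resolvent_mean n (x n) y)//.
set m := resolvent_mean n (x n) y in Lm Um m0 m1 *.
set d := v / n%:R in Lm Um.
have d_ge0 : 0 <= d by rewrite divr_ge0// ltW.
have cd0 : 0 <= y * expR (v / 2 - d / 2) by rewrite mulr_ge0 ?expR_ge0// ltW.
have ed1 : expR (- d) <= 1 by rewrite -expR0 ler_expR; lra.
have ed0 := expR_ge0 (- d).
rewrite ltr_distlC; apply/andP; split; rewrite ltNge; apply/negP => mw.
- have : s < y * expR (v / 2 - v / n%:R / 2) * (1 - (s - e)) * expR (- (v * expR (v / n%:R) * (s - e))).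
    near: n.
    have : y * expR (v / 2 - v / n%:R / 2) * (1 - (s - e)) * expR (- (v * expR (v / n%:R) * (s - e)))
        @[n --> \oo] --> y * expR (v / 2) * (1 - (s - e)) * expR (- (v * (s - e))).
      apply: cvgM; last by apply: exp_cvg; exact: cvgN.
      by apply: cvgM => //; exact: cvg_cst.
    move=> /cvgr_gt h; apply: h; rewrite -[ltLHS]ysE.
    apply: (@lt_trans _ _ (y * expR (v / 2) * (1 - (s - e)) * expR (- (v * s)))).
      by rewrite ltr_pM2r ?expR_gt0// ltr_pM2l//; lra.
    rewrite ltr_pM2l; last by rewrite mulr_gt0//; lra.
    by rewrite ltr_expR; lra.
  rewrite -/d; apply/negP; rewrite -leNgt; apply: (@le_trans _ _ m); last by lra.
  apply: le_trans Lm; apply: ler_pM; rewrite ?expR_ge0//.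
  + by rewrite mulr_ge0//; lra.
  + by rewrite ler_wpM2l//; lra.
  + by rewrite ler_expR lerN2 ler_wpM2l// mulr_ge0 ?expR_ge0// ltW.
- have : y * expR (v / 2 - v / n%:R / 2) * (1 - expR (- (v / n%:R)) * (s + e)) *
      expR (- (v * expR (- (v / n%:R)) * (s + e))) < s.
    near: n.
    have : y * expR (v / 2 - v / n%:R / 2) * (1 - expR (- (v / n%:R)) * (s + e)) *
        expR (- (v * expR (- (v / n%:R)) * (s + e)))
        @[n --> \oo] --> y * expR (v / 2) * (1 - (s + e)) * expR (- (v * (s + e))).
      apply: cvgM; last by apply: exp_cvg; exact: cvgN.
      apply: cvgM => //; apply: cvgB; first exact: cvg_cst.
      have : expR (- (v / n%:R)) * (s + e) @[n --> \oo] --> 1 * (s + e).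
        by apply: cvgM => //; exact: cvg_cst.
      by rewrite mul1r.
    move=> /cvgr_lt h; apply: h; rewrite -[ltRHS]ysE.
    apply: (@lt_le_trans _ _ (y * expR (v / 2) * (1 - s) * expR (- (v * (s + e))))).
      by rewrite ltr_pM2r ?expR_gt0// ltr_pM2l//; lra.
    rewrite ler_pM2l; last by rewrite mulr_gt0//; lra.
    by rewrite ler_expR; lra.
  rewrite -/d; apply/negP; rewrite -leNgt; apply: (@le_trans _ _ m); first by lra.
  apply: (le_trans Um); apply: ler_pM; rewrite ?expR_ge0//.
  + by rewrite mulr_ge0// subr_ge0 mulr_ile1.
  + by rewrite ler_wpM2l// lerB// ler_wpM2l.
  + by rewrite ler_expR lerN2 ler_wpM2l// mulr_ge0 ?expR_ge0// ltW.
Unshelve. all: by end_near.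
Qed.

End Limit.

(** Intermediate value theorem, after the equation is rewritten without its pole at
    s = 1. *)
Lemma exists_level v y : 0 < v -> 0 < y ->
  exists s, [/\ 0 < s, s < 1 & y = s / (1 - s) * expR (v * (s - 1 / 2))].
Proof.
move=> v0 y0.
pose g := fun s : R => s - y * (1 - s) * expR (- (v * (s - 1 / 2))).
have g0 : g 0 < 0.
  by rewrite /g sub0r oppr_lt0 subr0 mulr1 mulr_gt0 ?expR_gt0.
have g1 : g 1 = 1 by rewrite /g subrr mulr0 mul0r subr0.
have cg : continuous g.
  move=> s; apply: cvgB; first exact: cvg_id.
  apply: cvgM.
    by apply: cvgM; [exact: cvg_cst|apply: cvgB; [exact: cvg_cst|exact: cvg_id]].
  apply: continuous_cvg; first exact: continuous_expR.
  by apply: cvgN; apply: cvgM; [exact: cvg_cst|apply: cvgB; [exact: cvg_id|exact: cvg_cst]].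
have [||s] := @IVT R g 0 1 0 ler01.
- exact: continuous_subspaceT.
- by rewrite g1 ge_min le_max ltW// ler01 orbT.
rewrite in_itv/= => /andP[s0 s1] gs.
have sE : s = y * (1 - s) * expR (- (v * (s - 1 / 2))) by apply/eqP; rewrite -subr_eq0; apply/eqP.
have s0' : 0 < s.
  rewrite lt_neqAle s0 andbT; apply/eqP => s00; move: gs; rewrite -s00 => gs.
  by move: g0; rewrite gs ltxx.
have s1' : s < 1.
  rewrite lt_neqAle s1 andbT; apply/eqP => s11; move: gs; rewrite s11 g1 => /eqP.
  by rewrite oner_eq0.
exists s; split=> //; rewrite {1}sE expRN.
by field; rewrite !gt_eqF ?expR_gt0//; lra.
Qed.

End Asymptotics.

(** * Empirical measures of zeros *)

Section Empirical.
Context {R : realType}.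

Lemma Cpoly_Gpoly n (s : R) r : mesh_zeros n s r ->
  Cpoly (Gpoly n s) = \prod_(i < n) ('X - ((r i)%:C)%:P).
Proof.
case=> _ _ E; rewrite /Cpoly E rmorph_prod; apply: eq_bigr => i _.
by rewrite rmorphB/= map_polyX map_polyC.
Qed.

Lemma root_Cpoly_Gpoly n (s : R) (z : R[i]) : 0 < s -> root (Cpoly (Gpoly n s)) z ->
  exists2 x : R, 0 < x & z = x%:C.
Proof.
move=> s0; have [r mr] := mesh_zeros_exists n s0.
rewrite (Cpoly_Gpoly mr) /root horner_prod => /prodf_eq0[i _].
by rewrite hornerXsubC subr_eq0 => /eqP ->; exists (r i) => //; case: mr => + _ _; apply.
Qed.

Lemma perm_zeros_Gpoly n (s : R) r : mesh_zeros n s r ->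
  perm_eq (zeros (Cpoly (Gpoly n s))) [seq (r i)%:C | i <- iota 0 n].
Proof.
move=> mr; apply: prod_XsubC_eq.
rewrite /zeros; case: closed_field_poly_normal => zs /= E.
have monic : lead_coef (Cpoly (Gpoly n s)) = 1.
  by rewrite /Cpoly lead_coef_map lead_coef_Gpoly rmorph1.
rewrite -[LHS]scale1r -monic -E (Cpoly_Gpoly mr) big_map.
by rewrite -(big_mkord xpredT (fun i => 'X - ((r i)%:C)%:P)) /index_iota subn0.
Qed.

Lemma measurable_Cborel (f : R[i]^o -> R) : continuous f ->
  measurable_fun setT (f : Cborel R -> measurableTypeR R).
Proof.
move=> cf.
apply: (measurability (@RGenOpens.G R)) => [|/= _ [_] [a [b ->]] <-].
  exact: RGenOpens.measurableE.
rewrite setTI; apply: sub_sigma_algebra.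
by apply: open_comp => [x _|]; [exact: cf|exact: itv_open].
Qed.

Lemma ge0_integral_empirical (p : {poly R[i]}) (g : Cborel R -> R) :
  measurable_fun setT g -> (forall z, 0 <= g z) ->
  (\int[empirical_zeros p]_z (g z)%:E)%E =
  ((size p).-1%:R^-1 * \sum_(z <- zeros p) g z)%:E.
Proof.
move=> mg g0; have mg' : measurable_fun setT (EFin \o g) by exact/measurable_EFinP.
rewrite /empirical_zeros ge0_integral_mscale//; last by move=> z _; rewrite lee_fin.
rewrite ge0_integral_measure_sum//; last by move=> z _; rewrite lee_fin.
rewrite (big_nth 0) big_mkord EFinM -sumEFin; congr (_ * _)%E.
by apply: eq_bigr => i _; rewrite integral_dirac// diracT mul1e.
Qed.

(** Split into positive and negative parts, since integration against sums and
    multiples of measures is additive on nonnegative functions. *)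
Lemma Rintegral_empirical (p : {poly R[i]}) (f : Cborel R -> R) :
  measurable_fun setT f ->
  (\int[empirical_zeros p]_z f z)%R = (size p).-1%:R^-1 * \sum_(z <- zeros p) f z.
Proof.
move=> mf; pose g z := Num.max (f z) 0; pose h z := Num.max (- f z) 0.
have mg : measurable_fun setT g by exact: measurable_maxr.
have mh : measurable_fun setT h by apply: measurable_maxr => //; exact: measurable_funN.
rewrite /Rintegral integralE.
rewrite (_ : (fun x => (f x)%:E)^\+ = EFin \o g)%E; last first.
  by apply/funext => z; rewrite funeposE /= -EFin_max.
rewrite (_ : (fun x => (f x)%:E)^\- = EFin \o h)%E; last first.
  by apply/funext => z; rewrite funenegE /= -EFin_max.
rewrite !ge0_integral_empirical//=; last 2 first.
- by move=> z; rewrite le_max lexx orbT.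
- by move=> z; rewrite le_max lexx orbT.
rewrite -mulrBr -sumrB; congr (_ * _); apply: eq_bigr => z _.
by rewrite /g /h; case: (lerP 0 (f z)) => f0; [rewrite max_r|rewrite max_l]; lra.
Qed.

Lemma Rintegral_empirical_Gpoly n (s : R) r (f : R[i]^o -> R) : mesh_zeros n s r ->
  continuous f ->
  (\int[empirical_zeros (Cpoly (Gpoly n s))]_z f z)%R =
  n%:R^-1 * \sum_(i < n) f ((r i)%:C).
Proof.
move=> mr cf; rewrite Rintegral_empirical; last exact: measurable_Cborel.
rewrite /Cpoly size_map_poly size_Gpoly/= (perm_big _ (perm_zeros_Gpoly mr))/= big_map.
by rewrite -(big_mkord xpredT (fun i => f ((r i)%:C))) /index_iota subn0.
Qed.

End Empirical.

(** * The limit law and its transforms *)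

Section Law.
Context {R : realType} (v : R) (x : nat -> nat -> R) (nu : probability (measurableTypeR R) R).
Hypothesis v0 : 0 < v.
Hypothesis xP : forall n, (0 < n)%N -> mesh_zeros n (v / n%:R) (x n).
Hypothesis nu_ge0 : nu `[0, +oo[%classic = 1%E.
Hypothesis nu_lim : forall f : R -> R, continuous f -> (exists M, forall u, `|f u| <= M) ->
    row_mean x f @ \oo --> (\int[nu]_u f u)%R.

(** The point y at which the limit of the resolvent means is s. *)
Definition level s : R := s / (1 - s) * expR (v * (s - 1 / 2)).

Lemma level_gt0 s : 0 < s -> s < 1 -> 0 < level s.
Proof. by move=> s0 s1; rewrite /level mulr_gt0 ?expR_gt0// divr_gt0; lra. Qed.

Lemma nuC0 : nu (~` `[0, +oo[%classic) = 0%E.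
Proof. by rewrite probability_setC// nu_ge0 subee. Qed.

(** With y = -1/z, a bounded continuous function on the whole line which coincides
    with the integrand of psi at z on [0, +oo). *)
Let kern (y u : R) : R := y / (y + `|u|) - 1.

Lemma continuous_kern y : 0 < y -> continuous (kern y).
Proof.
move=> y0 u; apply: cvgB; last exact: cvg_cst.
apply: cvgM; first exact: cvg_cst.
apply: cvgV; first by rewrite gt_eqF// ltr_wpDr.
by apply: cvgD; [exact: cvg_cst|exact: norm_continuous].
Qed.

Lemma kern_bounded y u : 0 < y -> `|kern y u| <= 1.
Proof.
move=> y0; have u0 := normr_ge0 u; rewrite /kern.
have yu : 0 < y + `|u| by lra.
have h0 : 0 <= y / (y + `|u|) by rewrite divr_ge0; lra.
have h1 : y / (y + `|u|) <= 1 by rewrite ler_pdivrMr; lra.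
by rewrite ler_norml; lra.
Qed.

Lemma integrable_kern y : 0 < y -> nu.-integrable setT (EFin \o kern y).
Proof.
move=> y0; apply: integrable_bounded.
  by apply: continuous_measurable_fun; exact: continuous_kern.
by exists 1 => u; exact: kern_bounded.
Qed.

Lemma Rintegral_kern s : 0 < s -> s < 1 ->
  (\int[nu]_u kern (level s) u)%R = s - 1.
Proof.
move=> s0 s1; have y0 := level_gt0 s0 s1.
have lim1 : row_mean x (kern (level s)) @ \oo --> (\int[nu]_u kern (level s) u)%R.
  apply: nu_lim; first exact: continuous_kern.
  by exists 1 => u; exact: kern_bounded.
apply: (cvg_unique _ lim1) => //.
apply: (@cvg_trans _
  ((row_mean x (fun u => level s / (level s + u)) n - 1) @[n --> \oo])); last first.
  by apply: cvgB; [exact: cvg_resolvent_mean|exact: cvg_cst].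
apply: near_eq_cvg; near=> n.
have n0 : (0 < n)%N by near: n; exists 1%N.
have [r0 _ _] := xP n0.
apply/esym; rewrite /row_mean (eq_bigr (fun i : 'I_n => level s / (level s + x n i) - 1)); last first.
  by move=> i _; rewrite /kern gtr0_norm// r0.
rewrite sumrB mulrBr sumr_const card_ord; congr (_ - _).
by rewrite mulVf// pnatr_eq0 -lt0n.
Unshelve. all: by end_near.
Qed.

Lemma psi_level s : 0 < s -> s < 1 -> psi nu (- (level s)^-1) = s - 1.
Proof.
move=> s0 s1; have y0 := level_gt0 s0 s1; rewrite -Rintegral_kern// /psi.
set y := level s in y0 *.
transitivity (\int[nu]_(u in `[0%R, +oo[) kern y u)%R.
  apply: eq_Rintegral => u; rewrite inE/= in_itv/= andbT => u0.
  rewrite /kern ger0_norm//; field; rewrite !gt_eqF//=; lra.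
rewrite /Rintegral [in RHS](@negligible_integral _ _ _ nu setT (~` `[0, +oo[%classic))//.
- by rewrite setTD setCK.
- exact: measurableC.
- exact: integrable_kern.
- exact: nuC0.
Qed.

(** Every negative z is - 1 / level s for some s, where psi takes the value s - 1. *)
Lemma psi_inj : {in `]-oo, 0[ &, injective (psi nu)}.
Proof.
have H z : z < 0 -> exists s, [/\ 0 < s, s < 1 & z = - (level s)^-1].
  move=> z0; have [|s [s0 s1 E]] := @exists_level R v (- z^-1) v0.
    by rewrite oppr_gt0 invr_lt0.
  by exists s; split=> //; rewrite /level -E invrN opprK invrK.
move=> z z'; rewrite !in_itv/= => /H[s [s0 s1 ->]] /H[s' [s'0 s'1 ->]].
by rewrite !psi_level// => /addIr ->.
Qed.

Lemma Stransform_law t : -1 < t < 0 -> Stransform nu t = expR (- (v * (t + 1 / 2))).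
Proof.
move=> /andP[t1 t0]; rewrite /Stransform /psi_inv.
have s0 : 0 < 1 + t by lra.
have s1 : 1 + t < 1 by lra.
have -> : t = psi nu (- (level (1 + t))^-1) by rewrite psi_level// addrC addKr.
rewrite pinvKV; last 2 first.
- by move=> z z'; rewrite !inE; exact: psi_inj.
- by rewrite inE/= in_itv/= oppr_lt0 invr_gt0 level_gt0.
rewrite psi_level// [1 + t - 1](_ : _ = t); last by ring.
rewrite /level (_ : 1 + t - 1 / 2 = t + 1 / 2); last by field.
by rewrite expRN; field; rewrite (gt_eqF (expR_gt0 _)) (lt_eqF t0) !gt_eqF//; lra.
Qed.

Lemma Sigmatransform_law z : z < 0 ->
  Sigmatransform nu z = expR (v / 2 * ((z + 1) / (z - 1))).
Proof.
move=> z0; rewrite /Sigmatransform Stransform_law; last first.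
  apply/andP; split; last by rewrite ltr_pdivrMr; lra.
  by rewrite ltr_pdivlMr; lra.
have z1 : z - 1 < 0 by lra.
have z2 : 0 < 1 - z by lra.
by congr expR; field; rewrite (lt_eqF z1) (gt_eqF z2).
Qed.

(** The integrand of psi vanishes at 0, whereas psi takes the value -1/2. *)
Lemma law_neq_dirac0 : nu [set 0] <> 1%E.
Proof.
move=> nu01.
have h0 : 0 < 1 / 2 :> R by lra.
have h1 : 1 / 2 < 1 :> R by lra.
have := Rintegral_kern h0 h1; have y0 := level_gt0 h0 h1.
have m0 : measurable ([set 0] : set (measurableTypeR R)) by exact: measurable_set1.
have nuC : nu (~` [set 0]) = 0%E by rewrite probability_setC// nu01 subee.
rewrite /Rintegral (@negligible_integral _ _ _ nu setT (~` [set 0]))//.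
- rewrite setTD setCK (eq_integral (fun=> 0%E)) ?integral0/=; first lra.
  move=> u; rewrite inE/= => ->; rewrite /kern normr0 addr0 divff ?subrr//.
  by rewrite gt_eqF.
- exact: measurableC.
- exact: integrable_kern.
Qed.

Lemma law_weakly_cvg :
  weakly_cvg (fun n => empirical_zeros (Cpoly (Gpoly n (v / n%:R)))) (distribution nu (@toC R)).
Proof.
move=> f cf bf.
have [M fM] : exists M, forall z, `|f z| <= M.
  have [M [_ MP]] := bf; exists (M + 1) => z; apply: MP => //; lra.
have cg : continuous (f \o @toC R : R -> R).
  by move=> u; apply: continuous_comp; [exact: continuous_real_complex|exact: cf].
have mf : measurable_fun setT (f : Cborel R -> R) by exact: measurable_Cborel.
have -> : (\int[distribution nu (@toC R)]_z f z = \int[nu]_u f (toC u))%R.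
  rewrite /Rintegral integral_distribution//; first exact/measurable_EFinP.
  by apply: integrable_bounded; [exact: measurableT_comp|exists M => u; exact: fM].
apply: (@cvg_trans _ (row_mean x (f \o @toC R) @ \oo)); last first.
  by apply: nu_lim => //; exists M => u; exact: fM.
apply: near_eq_cvg; near=> n.
have n0 : (0 < n)%N by near: n; exists 1%N.
by rewrite (Rintegral_empirical_Gpoly (xP n0)).
Unshelve. all: by end_near.
Qed.

End Law.

Theorem theorem5p3 (R : realType) :
  (forall (sigma : R) (n : nat), 0 < sigma ->
     forall z : R[i], root (Cpoly (Gpoly n (sigma ^+ 2))) z ->
       exists2 x : R, 0 < x & z = x%:C) /\
  (forall sigma : R, 0 < sigma ->
     exists nu : probability (measurableTypeR R) R,
       [/\ nu `[0, +oo[%classic = 1%E,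
           weakly_cvg
             (fun n => empirical_zeros (Cpoly (Gpoly n (sigma ^+ 2 / n%:R))))
             (distribution nu (@toC R)),
           nu [set 0] <> 1%E,
           (forall t : R, -1 < t < 0 ->
              Stransform nu t = expR (- (sigma ^+ 2 * (t + 1 / 2)))) &
           (forall z : R, z < 0 ->
              Sigmatransform nu z =
                expR (sigma ^+ 2 / 2 * ((z + 1) / (z - 1))))]).
Proof.
split=> [sigma n s0 z|sigma s0]; first by apply: root_Cpoly_Gpoly; rewrite exprn_gt0.
have v0 : 0 < sigma ^+ 2 by rewrite exprn_gt0.
set v := sigma ^+ 2 in v0 *.
have /choice[x xP] : forall n, exists r : nat -> R, (0 < n)%N -> mesh_zeros n (v / n%:R) r.
  case=> [|n]; first by exists (fun=> 0).
  have [|r mr] := @mesh_zeros_exists R n.+1 (v / n.+1%:R); first by rewrite divr_gt0.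
  by exists r.
have x_gt0 n i : (i < n)%N -> 0 < x n i.
  by move=> i_n; have [+ _ _] := xP n (leq_ltn_trans (leq0n i) i_n); apply.
have x_sorted n i j : (i <= j)%N -> (j < n)%N -> x n i <= x n j.
  rewrite leq_eqVlt => /predU1P[->//|ij] jn.
  have n0 : (0 < n)%N by exact: leq_ltn_trans jn.
  have d0 : 0 < v / n%:R by rewrite divr_gt0// ltr0n.
  apply/ltW; apply: lt_trans (mesh_lt d0 (xP n n0) ij jn).
  by rewrite ltr_pMl ?x_gt0 ?(ltn_trans ij)// exprn_egt1// Gq_gt1.
have cvg_resolvent y : 0 < y -> cvgn (row_mean x (fun u => (y + u)^-1)).
  move=> y0; have [s [s0' s1 yE]] := exists_level v0 y0.
  rewrite (_ : (fun u => (y + u)^-1) = (fun u => y^-1 * (y / (y + u)))); last first.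
    by apply/funext => u; rewrite mulrA mulVf ?mul1r// gt_eqF.
  apply: is_cvg_row_mean_scale; apply/cvg_ex; exists s.
  by rewrite yE; exact: cvg_resolvent_mean.
have tight e : 0 < e -> exists2 y, 0 < y &
    \forall n \near \oo, 1 - e < row_mean x (fun u => y / (y + u)) n.
  move=> e0; have [s [s0' s1 se]] : exists s, [/\ 0 < s, s < 1 & 1 - e < s].
    have [e1|e1] := ltP e 1; first by exists (1 - e / 2); split; lra.
    by exists (1 / 2); split; lra.
  exists (level v s); first exact: level_gt0.
  by have /cvgr_gt := cvg_resolvent_mean v0 xP s0' s1; apply.
have [nu [nu0 nu_lim]] := exists_weak_limit x_gt0 x_sorted cvg_resolvent tight.
exists nu; split=> //.
- exact: law_weakly_cvg nu_lim.
- exact: law_neq_dirac0 v0 xP nu_lim.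
- by move=> t; exact: Stransform_law nu_lim _.
- by move=> z; exact: Sigmatransform_law nu_lim _.
Qed.
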